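(* Let $F\le F'\le\mathrm{Sym}(\Omega)$ and suppose $F$ is $2$-transitive. Then the pseudometric $\delta$ on the set $\partial G(F,F')$ of asymptotic classes of elements of $G(F,F')$ moving towards infinity induces the discrete topology.
   Context: $\mathbb{N}=\{1,2,\dots\}$, $\mathbb{N}_0=\mathbb{N}\cup\{0\}$. **Tree and groups.** $T$ is a locally finite regular (undirected, simple) tree with vertex set $V(T)$, edge set $E(T)\subset V(T)\times V(T)$ (each edge occurs as $(u,v)$ and as $(v,u)=\overline{(u,v)}$); $E(v)$ is the set of edges with origin $v$. $\Omega=\{0,\dots,\deg(T)-1\}$. Fix a legal colouring $c:E(T)\to\Omega$, i.e. $c(e)=c(\bar e)$ for all $e$ and $c|_{E(v)}:E(v)\to\Omega$ is a bijection for each $v$. For $g\in\mathrm{Aut}(T)$, $v\in V(T)$, the local action is $\sigma(g,v)=c\circ g\circ (c|_{E(v)})^{-1}\in\mathrm{Sym}(\Omega)$. For $F\le\mathrm{Sym}(\Omega)$, $U(F)=\{g\in\mathrm{Aut}(T):\sigma(g,v)\in F\ \forall v\in V(T)\}$ with the permutation topology. For $F\le F'\le\mathrm{Sym}(\Omega)$, $G(F,F')=\{g\in U(F'):\sigma(g,v)\in F\text{ for all but finitely many }v\}$, with the unique group topology making the inclusion $U(F)\to G(F,F')$ continuous and open; it is a totally disconnected locally compact group. $F$ is $2$-transitive if for all pairs $(a,b),(c,d)\in\Omega^2$ of distinct elements some $f\in F$ has $(f(a),f(b))=(c,d)$. **Scale, asymptotic relation, pseudometric.** Let $G$ be a t.d.l.c.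 group and $\mathrm{COS}(G)$ its set of compact open subgroups, with metric $d(U,V)=\log([U:U\cap V][V:U\cap V])$. For $g\in G$, $s(g)=\min\{[gUg^{-1}:gUg^{-1}\cap U]:U\in\mathrm{COS}(G)\}$; $g$ moves towards infinity if $s(g)>1$. For $g,h\in G$, $g\asymp h$ (asymptotic) if there exist $k,l\in\mathbb{N}$ and $U,V\in\mathrm{COS}(G)$ such that $d(g^{kn}Ug^{-kn},h^{ln}Vh^{-ln})$ is bounded over $n\in\mathbb{N}_0$; this is an equivalence relation. An element asymptotic to one moving towards infinity also moves towards infinity. $\partial G$ is the set of asymptotic classes of elements moving towards infinity. For $g,h$ moving towards infinity and $U,V\in\mathrm{COS}(G)$ set $$\delta_{+,n}^{U,V}(g,h)=\min\Big\{\tfrac{\log[g^nUg^{-n}:g^nUg^{-n}\cap h^kVh^{-k}]}{n\log s(g)}\ :\ k\in\mathbb{N}_0,\ s(h^k)\le s(g^n)\Big\},$$ $\delta_+(g,h)=\limsup_{n\to\infty}\delta_{+,n}^{U,V}(g,h)$ (independent of $U,V$), and $\delta(g,h)=\delta_+(g,h)+\delta_+(h,g)$. Then $\delta$ depends only on asymptotic classes and is a pseudometric on $\partial G$. *)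

(* Defs.v *)
From HB Require Import structures.
From mathcomp Require Import all_boot all_order all_algebra all_fingroup.
From mathcomp Require Import finmap all_classical all_reals.
From mathcomp Require Import topology sequences exp.

Set Implicit Arguments.
Unset Strict Implicit.
Unset Printing Implicit Defensive.

Import Order.TTheory GRing.Theory Num.Theory.

Local Open Scope classical_set_scope.
Local Open Scope card_scope.
Local Open Scope group_scope.

HB.mixin Record isTopologicalGroup G of monoid.Group G & Topological G := {
  mulg_continuous : continuous (fun xy : G * G => xy.1 * xy.2) ;
  invg_continuous : continuous (fun x : G => x^-1)
}.

#[short(type="topologicalGroupType")]
HB.structure Definition TopologicalGroup :=
  {G of monoid.Group G & Topological G & isTopologicalGroup G}.

Lemma mulg_continuousl (G : topologicalGroupType) (x : G) :
  continuous (fun y : G => x * y).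
Proof.
move=> y; apply: (@continuous_comp _ _ _ (fun y => (x, y))
  (fun xy : G * G => xy.1 * xy.2)); last exact: mulg_continuous.
by apply: cvg_pair; [exact: cvg_cst | exact: cvg_id].
Qed.

(* The least element of A; it is x0 when A has no least element. *)
Definition least (disp : Order.disp_t) (T : porderType disp) (x0 : T)
    (A : set T) : T :=
  xget x0 [set m | A m /\ lbound A m].

Section Groups.
Variable G : groupType.
Implicit Types (g : G) (U W : set G).

Definition is_subgroup U := U 1 /\ forall x y, U x -> U y -> U (x * y^-1).

(* g U g^-1; note that x ^ g is g^-1 * x * g in the library. *)
Definition conjset g U : set G := [set g * u * g^-1 | u in U].

(* [U : W] for a subgroup W of U, as the number of cosets u W. The value is 0
   when there are infinitely many of them, which does not happen for an open
   subgroup W of a compact group U. *)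
Definition coset_index U W : nat :=
  #|` fset_set [set [set u * w | w in W] | u in U] |.

End Groups.

Section Tdlc.
Variables (R : realType) (G : topologicalGroupType).
Implicit Types (g h : G) (U V : set G).

Definition COS : set (set G) :=
  [set U | [/\ is_subgroup U, open U & compact U]].

Definition cos_dist U V : R :=
  ln (coset_index U (U `&` V) * coset_index V (U `&` V))%N%:R.

Definition scale g : nat :=
  least 0%N [set coset_index (conjset g U) (conjset g U `&` U) | U in COS].

Definition towards_infinity g : Prop := (1 < scale g)%N.

Definition asymptotic g h : Prop :=
  exists k l : nat, exists U V : set G,
    [/\ (0 < k)%N, (0 < l)%N, COS U, COS V &
      exists M : R, forall n : nat,
        (cos_dist (conjset (g ^+ (k * n)) U) (conjset (h ^+ (l * n)) V) <= M)%R].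

Definition asymptotic_class g : set G := [set h | asymptotic g h].

(* The boundary as a set of classes; it is used as a type below. *)
Definition boundary : set (set G) :=
  [set asymptotic_class g | g in towards_infinity].

Definition delta_n U V g h (n : nat) : R :=
  least 0%R
    [set (ln (coset_index (conjset (g ^+ n) U)
                    (conjset (g ^+ n) U `&` conjset (h ^+ k) V))%:R
          / (n%:R * ln (scale g)%:R))%R
    | k in [set k : nat | (scale (h ^+ k) <= scale (g ^+ n))%N]].

(* The upper limit is taken in the extended reals, so that it makes sense
   before the sequence is known to be bounded. *)
Definition delta_plus U V g h : \bar R :=
  limn_esup (fun n => (delta_n U V g h n)%:E).

(* A representative, moving towards infinity, of a boundary point. *)
Definition boundary_repr (x : boundary) : G :=
  xget 1 [set g | towards_infinity g /\ asymptotic_class g = val x].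

Definition delta U V (x y : boundary) : \bar R :=
  (delta_plus U V (boundary_repr x) (boundary_repr y)
   + delta_plus U V (boundary_repr y) (boundary_repr x))%E.

End Tdlc.

Section PseudometricTopology.
Variables (R : realType) (X : Type) (delta : X -> X -> \bar R).

Definition pseudometric_open (O : set X) : Prop :=
  forall x, O x ->
    exists2 e : R, (0 < e)%R & [set y | (delta x y < e%:E)%E] `<=` O.

Definition induces_discrete_topology : Prop :=
  forall O : set X, pseudometric_open O.

End PseudometricTopology.

(* Acyclicity: no closed simple path on at least three vertices. *)
Record regular_tree (d : nat) := RegularTree {
  vertex :> choiceType ;
  adj : rel vertex ;
  vertex_nonempty : [set: vertex] !=set0 ;
  adj_sym : symmetric adj ;
  adj_irr : irreflexive adj ;
  adj_connected : forall x y, exists2 p, path adj x p & last x p = y ;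
  adj_acyclic : forall p, uniq p -> (2 < size p)%N -> ~~ path.cycle adj p ;
  adj_regular : forall x, [set y | adj x y] #= `I_d
}.

Section Tree.
Variables (d : nat) (T : regular_tree d).

Definition edge := {e : T * T | adj e.1 e.2}.

Definition origin (e : edge) : T := (val e).1.
Definition terminus (e : edge) : T := (val e).2.

Definition star (v : T) : set edge := [set e | origin e = v].

Lemma rev_edge_subproof (e : edge) : adj (terminus e) (origin e).
Proof. by rewrite adj_sym; exact: (valP e). Qed.

Definition rev_edge (e : edge) : edge :=
  exist _ (terminus e, origin e) (rev_edge_subproof e).

Record legal_colouring := LegalColouring {
  colour :> edge -> 'I_d ;
  colour_rev : forall e, colour (rev_edge e) = colour e ;
  colour_bij : forall v, set_bij (star v) [set: 'I_d] colour
}.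

Record aut := Aut {
  aut_fun :> T -> T ;
  aut_inv : T -> T ;
  autK : cancel aut_fun aut_inv ;
  autKV : cancel aut_inv aut_fun ;
  aut_adj : forall x y, adj (aut_fun x) (aut_fun y) = adj x y
}.

HB.instance Definition _ := gen_eqMixin aut.
HB.instance Definition _ := gen_choiceMixin aut.

Lemma aut_ext (g h : aut) : g =1 h -> g = h.
Proof.
case: g h => [f fi fK fVK fa] [f' fi' fK' fVK' fa'] /= /funext e; subst f'.
have e : fi = fi' by apply/funext => x; rewrite -[x in RHS]fVK fK'.
subst fi'; congr Aut; exact: Prop_irrelevance.
Qed.

Definition aut_one : aut :=
  @Aut id id (fun=> erefl) (fun=> erefl) (fun _ _ => erefl).

Lemma aut_mul_adj (g h : aut) x y : adj (g (h x)) (g (h y)) = adj x y.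
Proof. by rewrite !aut_adj. Qed.

Definition aut_mul (g h : aut) : aut :=
  @Aut (g \o h) (aut_inv h \o aut_inv g) (can_comp (autK g) (autK h))
    (can_comp (autKV h) (autKV g)) (aut_mul_adj g h).

Lemma aut_inv_adj (g : aut) x y : adj (aut_inv g x) (aut_inv g y) = adj x y.
Proof. by rewrite -(aut_adj g) !autKV. Qed.

Definition aut_invg (g : aut) : aut :=
  Aut (autKV g) (autK g) (aut_inv_adj g).

Let aut_mulA : associative aut_mul.
Proof. by move=> *; exact: aut_ext. Qed.
Let aut_mul1 : left_id aut_one aut_mul.
Proof. by move=> *; exact: aut_ext. Qed.
Let aut_1mul : right_id aut_one aut_mul.
Proof. by move=> *; exact: aut_ext. Qed.
Let aut_mulV : left_inverse aut_one aut_invg aut_mul.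
Proof. by move=> g; apply: aut_ext => x /=; rewrite autK. Qed.
Let aut_Vmul : right_inverse aut_one aut_invg aut_mul.
Proof. by move=> g; apply: aut_ext => x /=; rewrite autKV. Qed.

HB.instance Definition _ :=
  isGroup.Build aut aut_mulA aut_mul1 aut_1mul aut_mulV aut_Vmul.

Lemma aut1E x : (1 : aut) x = x. Proof. by []. Qed.
Lemma autME (g h : aut) x : (g * h) x = g (h x). Proof. by []. Qed.
Lemma aut_invE (g : aut) x : g^-1 x = aut_inv g x. Proof. by []. Qed.

(* The permutation topology on Aut(T): the automorphisms agreeing with g on a
   finite set of vertices form a basis of neighbourhoods of g. *)
Definition permutation_open (O : set aut) : Prop :=
  forall g, O g ->
    exists s : seq T, [set h : aut | {in s, h =1 g}] `<=` O.

Let permutation_openT : permutation_open setT.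
Proof. by move=> g _; exists [::]. Qed.

Let permutation_openI : setI_closed permutation_open.
Proof.
move=> A B oA oB g [/oA[s sA] /oB[t tB]]; exists (s ++ t) => h /= hst.
by split; [apply: sA | apply: tB] => x xs; apply: hst; rewrite mem_cat xs ?orbT.
Qed.

Let permutation_open_bigU (I : Type) (f : I -> set aut) :
  (forall i, permutation_open (f i)) -> permutation_open (\bigcup_i f i).
Proof.
by move=> of_ g [i _ /of_[s sf]]; exists s => h /sf fih; exists i.
Qed.

HB.instance Definition _ := isOpenTopological.Build aut
  permutation_openT permutation_openI permutation_open_bigU.

Definition aut_edge (g : aut) (e : edge) : edge :=
  exist _ (g (origin e), g (terminus e))
    (etrans (aut_adj g (origin e) (terminus e)) (valP e)).

Section LocalAction.
Variable c : legal_colouring.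

Lemma colour_edge_ex (v : T) (a : 'I_d) : exists e, star v e /\ c e = a.
Proof.
by have [_ _ /(_ a I)[e ve <-]] := colour_bij c v; exists e.
Qed.

(* The inverse of the restriction of c to E(v). *)
Definition colour_edge (v : T) (a : 'I_d) : edge :=
  projT1 (cid (colour_edge_ex v a)).

Lemma colour_edgeP v a : origin (colour_edge v a) = v /\ c (colour_edge v a) = a.
Proof. by rewrite /colour_edge; case: cid. Qed.

Lemma colour_edgeK v e : origin e = v -> colour_edge v (c e) = e.
Proof.
move=> ev; have [_ cI _] := colour_bij c v.
by have [oe ce] := colour_edgeP v (c e); apply: cI => //; exact/mem_set.
Qed.

Definition local_fun (g : aut) (v : T) (a : 'I_d) : 'I_d :=
  c (aut_edge g (colour_edge v a)).

Lemma aut_edge_origin g e : origin (aut_edge g e) = g (origin e).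
Proof. by []. Qed.

Lemma aut_edgeM g h e : aut_edge (g * h) e = aut_edge g (aut_edge h e).
Proof. exact/val_inj. Qed.

Lemma aut_edge1 e : aut_edge 1 e = e.
Proof. by apply/val_inj; case: e => [[]]. Qed.

Lemma local_fun1 v : local_fun 1 v =1 id.
Proof. by move=> a; rewrite /local_fun aut_edge1 (colour_edgeP v a).2. Qed.

Lemma local_funM g h v a :
  local_fun (g * h) v a = local_fun g (h v) (local_fun h v a).
Proof.
rewrite /local_fun aut_edgeM [in RHS]colour_edgeK//.
by rewrite aut_edge_origin (colour_edgeP v a).1.
Qed.

Lemma local_fun_inj g v : injective (local_fun g v).
Proof.
apply: (@can_inj _ _ _ (local_fun g^-1 (g v))) => a.
by rewrite -local_funM mulVg local_fun1.
Qed.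

Definition local_action (g : aut) (v : T) : 'S_d :=
  perm (@local_fun_inj g v).

(* Permutations of a finite type are composed from left to right in the
   library, hence the order of the factors. *)
Lemma local_actionM g h v :
  local_action (g * h) v = local_action h v * local_action g (h v).
Proof. by apply/permP => a; rewrite permM !permE local_funM. Qed.

Lemma local_action1 v : local_action 1 v = 1.
Proof. by apply/permP => a; rewrite !permE local_fun1. Qed.

Lemma local_actionV g v :
  local_action g^-1 v = (local_action g (g^-1 v))^-1.
Proof.
apply: (mulIg (local_action g (g^-1 v))).
by rewrite -local_actionM mulVg mulgV local_action1.
Qed.

End LocalAction.
End Tree.

Section BurgerMozes.
Variables (d : nat) (T : regular_tree d) (c : legal_colouring T).

(* U(F), which carries the permutation topology as a subspace of Aut(T). *)
Definition universal_group (F : {group 'S_d}) : set (aut T) :=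
  [set g | forall v, local_action c g v \in F].

Definition almost_universal (F F' : {group 'S_d}) (g : aut T) : Prop :=
  universal_group F' g /\ finite_set [set v | local_action c g v \notin F].

Definition two_transitive (F : {group 'S_d}) : Prop :=
  forall a b a' b' : 'I_d, a != b -> a' != b' ->
    exists2 f : 'S_d, f \in F & f a = a' /\ f b = b'.

End BurgerMozes.

Section GFF.
Variables (d : nat) (T : regular_tree d) (c : legal_colouring T).
Variables (F F' : {group 'S_d}).

Lemma almost_universal_group_closed :
  group_closed [pred g | `[< almost_universal c F F' g >]].
Proof.
split=> [|g h].
  apply/asboolP; split=> [v|]; first by rewrite local_action1 group1.
  rewrite (_ : [set v | _] = set0)//; apply/seteqP; split=> // v /=.
  by rewrite local_action1 group1.
move=> /asboolP[gF' gF] /asboolP[hF' hF]; apply/asboolP; split=> [v|].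
  by rewrite local_actionM local_actionV groupM ?groupV.
pose A := [set v | local_action c g v \notin F].
pose B := [set v | local_action c h v \notin F].
apply: (@sub_finite_set _ _ ([set h v | v in A] `|` [set h v | v in B])).
  move=> v /=; rewrite local_actionM local_actionV.
  set w := h^-1 v => ghF.
  have hw : h w = v by rewrite /w -autME mulgV.
  have [Fh|nFh] := boolP (local_action c h w \in F); last by right; exists w.
  left; exists w => //; rewrite /A /=; apply: contra ghF => Fg.
  by rewrite groupM ?groupV.
by rewrite finite_setU; split; exact: finite_image.
Qed.

(* The group G(F,F'). Its topology, defined below, is in general finer than the
   one induced by Aut(T), which is why it is not a type of the form set_type. *)
Record GFF (sFF' : F \subset F') := MkGFF {
  GFF_val :> aut T ;
  GFF_valP : `[< almost_universal c F F' GFF_val >]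
}.

Variable sFF' : F \subset F'.

HB.instance Definition _ := [isSub for @GFF_val sFF'].
HB.instance Definition _ := [Choice of GFF sFF' by <:].

HB.instance Definition _ :=
  SubChoice_isSubGroup.Build _ _ (GFF sFF') almost_universal_group_closed.

Lemma universal_groupP (u : aut T) :
  universal_group c F u -> `[< almost_universal c F F' u >].
Proof.
move=> uF; apply/asboolP; split=> [v|]; first exact: (fintype.subsetP sFF' _ (uF v)).
rewrite (_ : [set v | _] = set0)//; apply/seteqP; split=> // v /=.
by rewrite uF.
Qed.

Definition universal_incl (u : universal_group c F) : GFF sFF' :=
  MkGFF sFF' (universal_groupP (set_valP u)).

(* All the translates of U(F) in G(F,F') are open, and each of them is
   homeomorphic to U(F). *)
Definition GFF_open (O : set (GFF sFF')) : Prop :=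
  forall g : GFF sFF', open [set u : universal_group c F | O (g * universal_incl u)].

Let GFF_openT : GFF_open setT.
Proof. by move=> g; exact: openT. Qed.

Let GFF_openI : setI_closed GFF_open.
Proof. by move=> A B oA oB g; exact: (openI (oA g) (oB g)). Qed.

Let GFF_open_bigU (I : Type) (f : I -> set (GFF sFF')) :
  (forall i, GFF_open (f i)) -> GFF_open (\bigcup_i f i).
Proof.
move=> fo g; rewrite (_ : [set u | _] =
  \bigcup_i [set u | f i (g * universal_incl u)])//.
by apply: bigcup_open => i _; exact: (fo i g).
Qed.

HB.instance Definition _ :=
  isOpenTopological.Build (GFF sFF') GFF_openT GFF_openI GFF_open_bigU.

Lemma universal_group1 : universal_group c F 1.
Proof. by move=> v; rewrite local_action1 group1. Qed.

Lemma universal_groupM u v : universal_group c F u -> universal_group c F v ->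
  universal_group c F (u * v).
Proof. by move=> uF vF x; rewrite local_actionM groupM. Qed.

Lemma universal_groupV u : universal_group c F u -> universal_group c F u^-1.
Proof. by move=> uF x; rewrite local_actionV groupV. Qed.

(* The pointwise stabilizer of s in U(F), as a subset of G(F,F'). *)
Definition GFF_stab (s : seq T) : set (GFF sFF') :=
  [set g | universal_group c F g /\ {in s, forall x, g x = x}].

Lemma GFF_stab_incl (g : GFF sFF') s : GFF_stab s g ->
  exists u : universal_group c F, g = universal_incl u.
Proof.
by move=> [gF _]; exists (exist _ (val g) (mem_set gF)); exact/val_inj.
Qed.

Lemma GFF_valM (g h : GFF sFF') x : (g * h) x = g (h x).
Proof. by []. Qed.

Lemma GFF_mulVK (g : GFF sFF') x : g^-1 (g x) = x.
Proof. by rewrite -GFF_valM mulVg. Qed.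

Lemma GFF_mulKV (g : GFF sFF') x : g (g^-1 x) = x.
Proof. by rewrite -GFF_valM mulgV. Qed.

Lemma open_aut_stab (s : seq T) : open [set h : aut T | {in s, forall x, h x = x}].
Proof. by move=> g gs; exists s => h hg x xs; rewrite hg// gs. Qed.

Lemma GFF_open_stab (g : GFF sFF') s : open [set g * b | b in GFF_stab s].
Proof.
move=> h; set k := g^-1 * h.
have gE (u : universal_group c F) :
    [set g * b | b in GFF_stab s] (h * universal_incl u) <->
    GFF_stab s (k * universal_incl u).
  split=> [[b bs gb]|ks]; last by exists (k * universal_incl u) => //;
    rewrite /k !mulgA mulgV mul1g.
  by rewrite (_ : k * _ = b)// /k -mulgA -gb mulgA mulVg mul1g.
have [kF|nkF] := pselect (universal_group c F k).
  exists [set w : aut T | {in s, forall x, k (w x) = x}].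
    by move=> w ws; exists s => v vw x xs /=; rewrite vw//; exact: ws.
  apply/seteqP; split=> u /=.
    move=> us; apply/gE; split=> [|x /us//].
    exact: universal_groupM kF (set_valP u).
  by move=> /gE[_ ks] x /ks.
exists set0; first exact: open0.
apply/seteqP; split=> u //= /gE[kuF _]; apply: nkF.
have := universal_groupM kuF (universal_groupV (set_valP u)).
by rewrite -mulgA mulgV mulg1.
Qed.

Lemma nbhs_GFF (g : GFF sFF') (A : set (GFF sFF')) :
  nbhs g A <-> exists s, [set g * b | b in GFF_stab s] `<=` A.
Proof.
split=> [|[s sA]]; last first.
  apply: filterS sA _; apply: open_nbhs_nbhs; split; first exact: GFF_open_stab.
  exists 1; last by rewrite mulg1.
  by split=> //; exact: universal_group1.
rewrite nbhsE => -[O [oO Og] OA].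
have [W oW WO] := oO g.
have W1 : W 1.
  pose e : universal_group c F := exist _ 1 (mem_set universal_group1).
  suff : [set u : universal_group c F | O (g * universal_incl u)] e.
    by rewrite -WO.
  rewrite /= (_ : universal_incl e = 1) ?mulg1//; exact/val_inj.
have [s sW] := oW 1 W1.
exists s => _ [b bs <-]; apply: OA.
have [u bu] := GFF_stab_incl bs.
suff : [set u : universal_group c F | O (g * universal_incl u)] u by rewrite bu.
rewrite -WO /=; apply: sW => x xs; have := bs.2 x xs.
by rewrite bu.
Qed.

Lemma GFF_stabM s (g h : GFF sFF') :
  GFF_stab s g -> GFF_stab s h -> GFF_stab s (g * h).
Proof.
move=> [gF gs] [hF hs]; split; first exact: universal_groupM.
by move=> x xs; rewrite GFF_valM hs// gs.
Qed.

Lemma GFF_stabV s (g : GFF sFF') : GFF_stab s g -> GFF_stab s g^-1.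
Proof.
move=> [gF gs]; split; first exact: universal_groupV.
by move=> x xs; rewrite -[x in LHS]gs// GFF_mulVK.
Qed.

Lemma adj_seq (x : T) : exists s : seq T, forall y, adj x y -> y \in s.
Proof.
have : finite_set [set y | adj x y] by exists d; exact: adj_regular.
case/finite_seqP => s es; exists s => y xy.
by have : [set y | adj x y] y := xy; rewrite es.
Qed.

Lemma local_action_fix (g : aut T) x :
  g x = x -> (forall y, adj x y -> g y = y) -> local_action c g x = 1.
Proof.
move=> gx gy; apply/permP => a; rewrite permE perm1 /local_fun.
have [oe ce] := colour_edgeP c x a.
rewrite -[RHS]ce; congr (c _); apply/val_inj => /=.
move: (colour_edge c x a) oe {ce} => [[y z] /= yz]; rewrite /origin /= => yx.
by rewrite /terminus /= yx gx gy// -yx.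
Qed.

Lemma GFF_stab_conj (g : GFF sFF') s : exists t, forall b,
  GFF_stab t b -> GFF_stab s (g * b * g^-1).
Proof.
have /asboolP[_ /finite_seqP[t0 et0]] := GFF_valP g.
pose nb x := projT1 (cid (adj_seq x)).
have nbP x y : adj x y -> y \in nb x by exact: (projT2 (cid (adj_seq x)) y).
exists (t0 ++ flatten (map nb t0) ++ [seq g^-1 x | x <- s]) => b [bF bt].
split=> [v|x xs]; last first.
  rewrite !GFF_valM bt ?GFF_mulKV//.
  by rewrite !mem_cat (map_f (fun x => g^-1 x))// !orbT.
rewrite /= !local_actionM local_actionV.
set w := (val g)^-1 v.
have [wt|wt] := boolP (w \in t0).
  have bw : b w = w by rewrite bt// mem_cat wt.
  have -> : local_action c b w = 1.
    apply: local_action_fix => // y /nbP yw; apply: bt; rewrite !mem_cat orbCA.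
    by apply/orP; left; apply/flattenP; exists (nb w) => //; exact: map_f.
  rewrite -[(val b) w]/(b w) bw mul1g mulVg; exact: group1.
have gF v' : v' \notin t0 -> local_action c g v' \in F.
  move=> v't; apply/negPn; apply: contra v't => gv'.
  by have : [set v | local_action c g v \notin F] v' := gv'; rewrite et0.
rewrite groupM ?groupV ?gF// groupM ?gF//.
apply: contra wt => bwt; rewrite -(GFF_mulVK b w).
have := (GFF_stabV (conj bF bt)).2 (b w); rewrite mem_cat bwt => ->//.
Qed.

Lemma GFF_mulg_continuous :
  continuous (fun xy : GFF sFF' * GFF sFF' => xy.1 * xy.2).
Proof.
move=> [x y] A /nbhs_GFF[s sA] /=.
have [t ts] := GFF_stab_conj y^-1 s.
exists ([set x * b | b in GFF_stab t], [set y * b | b in GFF_stab s]).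
  by split; apply/nbhs_GFF; [exists t | exists s].
move=> [_ _] /= [[b bt <-] [b' b's <-]]; apply: sA.
exists (y^-1 * b * y^-1^-1 * b'); first by apply: GFF_stabM => //; exact: ts.
by rewrite invgK !mulgA mulgK.
Qed.

Lemma GFF_invg_continuous : continuous (fun x : GFF sFF' => x^-1).
Proof.
move=> x A /nbhs_GFF[s sA].
have [t ts] := GFF_stab_conj x s.
apply/nbhs_GFF; exists t => _ [b bt <-]; apply: sA.
exists (x * b^-1 * x^-1); first by apply: ts; exact: GFF_stabV.
by rewrite invgM !mulgA mulVg mul1g.
Qed.

HB.instance Definition _ := isTopologicalGroup.Build (GFF sFF')
  GFF_mulg_continuous GFF_invg_continuous.

Lemma universal_incl_continuous :
  continuous (universal_incl : universal_group c F -> GFF sFF').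
Proof.
apply/continuousP => O oO; have := oO 1.
by under eq_set do rewrite mul1g.
Qed.

Lemma universal_incl_open (A : set (universal_group c F)) :
  open A -> open [set universal_incl u | u in A].
Proof.
move=> [W oW WA]; rewrite openE => _ [u Au <-].
have Wu : W (set_val u) by move: Au; rewrite -WA.
have [s sW] := oW _ Wu.
apply/nbhs_GFF; exists s => _ [b bs <-].
have [v bv] := GFF_stab_incl bs; subst b.
exists (exist _ (set_val u * set_val v)
  (mem_set (universal_groupM (set_valP u) (set_valP v)))); last exact/val_inj.
by rewrite -WA; apply: sW => x xs /=; have /= := bs.2 x xs => {2}<-.
Qed.

(* The topology of G(F,F') is characterized by the properties above. *)
Lemma GFF_topology_unique (H : topologicalGroupType) (f : GFF sFF' -> H) :
  {morph f : x y / x * y} -> bijective f ->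
  continuous (f \o universal_incl) ->
  (forall A : set (universal_group c F),
     open A -> open [set f (universal_incl u) | u in A]) ->
  forall O : set (GFF sFF'), open O <-> open [set f g | g in O].
Proof.
move=> fM [f' fK f'K] fc fo O; split=> [oO|ofO].
  rewrite openE => _ [g Og <-].
  have /fo oB := oO g.
  have /continuousP/(_ _ oB) := @mulg_continuousl H (f g)^-1.
  rewrite openE => /(_ (f g)) /=.
  have fiu : f (universal_incl (exist _ 1 (mem_set universal_group1))) = 1.
    rewrite (_ : universal_incl _ = 1); last exact/val_inj.
    by apply: (mulgI (f 1)); rewrite -fM !mulg1.
  have H1 : [set f (universal_incl u) | u in
      [set u | O (g * universal_incl u)]] ((f g)^-1 * f g).
    rewrite mulVg; exists (exist _ 1 (mem_set universal_group1)); last exact: fiu.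
    rewrite /=.
    by rewrite (_ : universal_incl _ = 1) ?mulg1//; exact/val_inj.
  move=> /(_ H1); apply: filterS => y [u /= gu uy].
  by exists (g * universal_incl u) => //; rewrite fM uy mulgA mulgV mul1g.
move=> g; have /continuousP/(_ _ ofO) := @mulg_continuousl H (f g).
move/continuousP : fc => /[apply]; congr (open _).
apply/seteqP; split=> u /= => [[h Oh]|Ogu]; last first.
  by exists (g * universal_incl u) => //; exact: fM.
by rewrite -fM => /(can_inj fK) <-.
Qed.

End GFF.

(* Main.v *)
Require Import Defs.
From mathcomp Require Import all_boot all_order all_algebra all_fingroup.
From mathcomp Require Import finmap all_classical all_reals topology.
From mathcomp Require Import sequences exp normedtype ereal zify ring.

(** The idea is that [delta_plus g h] is either bounded below by a constant
    depending only on [g], or [g] and [h] are asymptotic.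

    To two elements [a] and [b] of G(F,F') attach the finite set [diff a b] of
    the vertices at which the local actions of their inverses are in different
    cosets of F. It depends only on the cosets a U(F) and b U(F), it moves with
    left translations, and it satisfies a triangle inequality; it is preserved
    by the elements that lie in the conjugates of U(F) by [a] and by [b]. Fix a
    vertex v. The index of the intersection with b V b^-1 in a U a^-1 therefore
    bounds, up to a constant, the size of certain orbits: the orbits, under the
    conjugate by [a] of the stabilizer in U(F) of a finite set, of the vertex
    b v ([vertex_bound]) and, up to the size of [diff a b], of any vertex of
    [diff a b] ([diff_bound]). Because F is 2-transitive, the orbit of a vertex
    at distance n from a v is exponentially large in n ([large_orbit]).

    An element that moves towards infinity is a translation, and the tree then
    has degree at least 3 ([towards_infinity_hyperbolic],
    [towards_infinity_degree]): otherwise it normalizes a compact open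
    subgroup. If [delta_plus g h] is small, then for large n some k makes the
    index for a = g^n and b = h^k less than 2^(n/4). By the first bound h^k v is
    within n/4 or so of g^n v, which forces the attracting ends of g and h to
    be equal ([same_end]). By the second one a fixed vertex z, whose distance to
    g^n v is about n or more, cannot be in [diff (g^n) (h^k)]
    ([diff_eventually_empty]), the size of this set being linear in n.

    Choose powers of g and h with the same translation length along the common
    ray. The last fact says that they agree in the limit, so a vertex where
    their n-th powers differ comes from a later factor of one of them; it also
    comes from an earlier factor, so it is at a bounded distance from g^n v
    ([powers_stay_close]). Finitely many left cosets of U contain all
    elements that move v by a bounded distance and have local actions in F away
    from v ([finitely_many_cosets]); hence the distances between the conjugates of U by
    these powers take finitely many values, and g and h are asymptotic. *)

Set Implicit Arguments.
Unset Strict Implicit.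
Unset Printing Implicit Defensive.

Import Order.TTheory GRing.Theory Num.Theory.

Local Open Scope classical_set_scope.
Local Open Scope group_scope.
Local Open Scope nat_scope.

(** * Colour words, geodesics and rays in a coloured tree *)

Section ColouredTree.
Variables (d : nat) (T : regular_tree d) (c : legal_colouring T).
Implicit Types (x y z v : T) (a b : 'I_d) (s t : seq 'I_d) (g h : Defs.aut T).

Definition nbr v a : T := terminus (colour_edge c v a).

Lemma adj_nbr v a : adj v (nbr v a).
Proof.
have [oe _] := colour_edgeP c v a.
by rewrite /nbr -{1}oe; exact: (valP (colour_edge c v a)).
Qed.

Lemma adj_nbrP v z : adj v z -> exists a, z = nbr v a.
Proof.
move=> vz; pose e : edge T := exist _ (v, z) vz.
by exists (c e); rewrite /nbr (@colour_edgeK _ _ c v e).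
Qed.

Lemma nbrK v a : nbr (nbr v a) a = v.
Proof.
have [oe ce] := colour_edgeP c v a; set e := colour_edge c v a in oe ce *.
have := @colour_edgeK _ _ c (nbr v a) (rev_edge e) erefl.
by rewrite colour_rev ce /nbr => ->.
Qed.

Lemma nbr_inj v : injective (nbr v).
Proof.
move=> a b ab; have [oa ca] := colour_edgeP c v a.
have [ob cb] := colour_edgeP c v b; rewrite -ca -cb; congr (c _).
move: oa ob ab {ca cb}; rewrite /nbr; set e := colour_edge c v a.
set e' := colour_edge c v b; rewrite /origin /terminus => oa ob ab.
apply: val_inj; case: (val e) (val e') oa ob ab => [x y] [x' y'] /=.
by move=> -> -> ->.
Qed.

Lemma aut_nbr g v a : g (nbr v a) = nbr (g v) (local_fun c g v a).
Proof.
have [oe _] := colour_edgeP c v a.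
rewrite {2}/nbr /local_fun colour_edgeK//.
by rewrite aut_edge_origin oe.
Qed.

(** Colour words are read from right to left, so that prepending a letter
    moves to an adjacent vertex. *)
Definition node v t : T := foldr (fun a z => nbr z a) v t.

(** Repeating a colour means going back along the same edge, so the reduced
    words are the paths without backtracking. *)
Definition reduced t := sorted (fun a b => a != b) t.

Lemma node_cat v s t : node v (s ++ t) = node (node v t) s.
Proof. exact: foldr_cat. Qed.

Lemma node_rev v t : node (node v t) (rev t) = v.
Proof.
elim: t => //= a t IH; rewrite rev_cons -cats1 node_cat /= nbrK; exact: IH.
Qed.

Lemma reduced_cons a t : reduced (a :: t) -> reduced t.
Proof. by case: t => //= b t /andP[]. Qed.

Lemma reduced_drop n t : reduced t -> reduced (drop n t).
Proof. exact: drop_sorted. Qed.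

Lemma reduced_rev t : reduced (rev t) = reduced t.
Proof.
by rewrite /reduced rev_sorted; apply: eq_sorted => a b /=; rewrite eq_sym.
Qed.

Lemma reduced_cat_rcons s t a b :
  reduced (rcons s a) -> reduced (b :: t) -> a != b ->
  reduced (rcons s a ++ b :: t).
Proof.
case: s => [|e s] /=; first by move=> _ ? ->.
by move=> sa bt ab; rewrite cat_path sa last_rcons /= ab.
Qed.

Fixpoint trail v t : seq T :=
  if t is a :: t' then node v t :: trail v t' else [:: v].

Lemma size_trail v t : size (trail v t) = (size t).+1.
Proof. by elim: t => //= a t ->. Qed.

Lemma last_trail v t x : last x (trail v t) = v.
Proof. by elim: t x => //=. Qed.

Lemma trailP v t x : x \in trail v t ->
  exists t1 t2, t = t1 ++ t2 /\ x = node v t2.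
Proof.
elim: t => [|a t IH] /=; rewrite inE.
  by move=> /eqP ->; exists [::], [::].
case/orP=> [/eqP -> | /IH[t1 [t2 [-> ->]]]]; first by exists [::], (a :: t).
by exists (a :: t1), t2.
Qed.

Lemma path_trail v t a : path (@adj d T) (node v (a :: t)) (trail v t).
Proof.
elim: t a => [|b t IH] a; first by rewrite /= andbT adj_sym adj_nbr.
rewrite [path _ _ _]/=; apply/andP; split; last exact: IH.
by rewrite adj_sym adj_nbr.
Qed.

(** The shortest closed reduced word would run around a simple cycle. *)
Lemma reduced_closed v t : reduced t -> node v t = v -> t = [::].
Proof.
suff H n u v' : size u <= n -> reduced u -> node v' u = v' -> u = [::].
  exact: (H (size t)).
elim: n u v' => [|n IH] u v'; first by case: u.
case: u => // a u; rewrite ltnS => un red cl.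
have up w : size w <= n -> reduced w -> uniq (trail v' w).
  elim: w => //= b w IHw wn bw.
  rewrite IHw ?(reduced_cons bw)// 1?ltnW// andbT.
  apply/negP => /trailP[w1 [w2 [wE e]]].
  have {}e : node (node v' w2) (b :: w1) = node v' w2.
    by rewrite -[RHS]e -node_cat /= -wE.
  move: wn bw; rewrite wE => wn bw.
  suff : b :: w1 = [::] by [].
  apply: (IH _ _ _ _ e).
    by move: wn; rewrite /= size_cat; lia.
  by move: bw; rewrite /reduced /= cat_path => /andP[].
have {up} := up _ un (reduced_cons red) => up.
have [u2|u2] := leqP 2 (size u).
  have := adj_acyclic up; rewrite size_trail ltnS => /(_ u2)/negP; case.
  rewrite (@cycle_path _ v') last_trail.
  by have := path_trail v' u a; rewrite cl.
case: u u2 {un up} red cl => [|b [|//]] _ /=.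
  by move=> _ cl; have := adj_nbr v' a; rewrite cl adj_irr.
rewrite andbT => /eqP ab cl; case: ab; apply: (@nbr_inj (nbr v' b)).
by rewrite cl nbrK.
Qed.

Lemma nbr_cancel a x y : nbr x a = nbr y a -> x = y.
Proof. by move=> e; rewrite -(nbrK x a) e nbrK. Qed.

Lemma node_inj v s t : reduced s -> reduced t -> node v s = node v t -> s = t.
Proof.
elim: s t => [|a s IH] t; first by move=> _ rt /esym/(reduced_closed rt).
case: t => [|b t] rs rt; first by move=> /(reduced_closed rs).
have [ab | ab] /= := eqVneq a b => [|st].
  rewrite -ab => /nbr_cancel /IH -> //; first exact: reduced_cons rs.
  exact: reduced_cons rt.
have : rev (b :: t) ++ a :: s = [::].
  apply: (@reduced_closed v); last by rewrite node_cat -[RHS](node_rev v (b :: t)) /= st.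
  rewrite rev_cons; apply: reduced_cat_rcons; rewrite // 1?eq_sym//.
  by rewrite -rev_cons reduced_rev.
by move/(congr1 size); rewrite size_cat /= addnS.
Qed.

Lemma node_surj v x : exists2 t, reduced t & node v t = x.
Proof.
have [p vp <-] := adj_connected v x.
elim/last_ind: p vp => [|p y IH]; first by exists [::].
rewrite rcons_path last_rcons => /andP[/IH[t rt <-]] /adj_nbrP[a ->].
case: t rt => [|b t] rt; first by exists [:: a].
have [->|ab] := eqVneq a b; last by exists [:: a, b & t] => //=; rewrite ab.
by exists t; [exact: reduced_cons rt | rewrite /= nbrK].
Qed.

Definition word v x : seq 'I_d := projT1 (cid2 (node_surj v x)).

Lemma reduced_word v x : reduced (word v x).
Proof. by rewrite /word; case: cid2. Qed.

Lemma node_word v x : node v (word v x) = x.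
Proof. by rewrite /word; case: cid2. Qed.

Lemma wordK v t : reduced t -> word v (node v t) = t.
Proof.
by move=> rt; apply: (@node_inj v); rewrite ?node_word//; exact: reduced_word.
Qed.

Lemma word_nbr v x a :
  word v (nbr x a) =
  if word v x is b :: t then if a == b then t else a :: b :: t else [:: a].
Proof.
rewrite -[in LHS](node_word v x).
case: (word v x) (reduced_word v x) => [|b t] rt; first exact: (@wordK v [:: a]).
have [->|ab] := eqVneq a b; last by apply: (@wordK v [:: a, b & t]); rewrite /= ab.
by rewrite /= nbrK wordK//; exact: reduced_cons rt.
Qed.

Definition dist x y := size (word x y).

Lemma dist_node v t : reduced t -> dist v (node v t) = size t.
Proof. by move=> rt; rewrite /dist wordK. Qed.

Lemma dist_nbr_le v x a : dist v (nbr x a) <= (dist v x).+1.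
Proof.
rewrite /dist word_nbr; case: (word v x) => //= b t; case: ifP => //= _.
by lia.
Qed.

Lemma dist_node_le v t : dist v (node v t) <= size t.
Proof.
elim: t => [|a t IH] /=; first exact: eq_leq (@dist_node v [::] isT).
exact: leq_trans (dist_nbr_le _ _ _) _.
Qed.

Lemma dist_triangle y x z : dist x z <= dist x y + dist y z.
Proof.
rewrite -{1}(node_word y z) -{1}(node_word x y) -node_cat.
by rewrite (leq_trans (dist_node_le _ _))// size_cat addnC.
Qed.

Lemma dist_sym x y : dist x y = dist y x.
Proof.
suff H u v : dist u v <= dist v u by apply/eqP; rewrite eqn_leq !H.
have := node_rev v (word v u); rewrite node_word => {1}<-.
by rewrite (leq_trans (dist_node_le _ _))// size_rev.
Qed.

Lemma dist0 x y : dist x y = 0 -> x = y.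
Proof. by move=> /size0nil e; rewrite -(node_word x y) e. Qed.

Lemma distxx x : dist x x = 0.
Proof. exact: (@dist_node x [::] isT). Qed.

Fixpoint aut_word g v t : seq 'I_d :=
  if t is a :: t' then local_fun c g (node v t') a :: aut_word g v t' else [::].

Lemma size_aut_word g v t : size (aut_word g v t) = size t.
Proof. by elim: t => //= a t ->. Qed.

Lemma aut_node g v t : g (node v t) = node (g v) (aut_word g v t).
Proof. by elim: t => //= a t IH; rewrite aut_nbr IH. Qed.

Lemma aut_inj g : injective g.
Proof. exact: can_inj (autK g). Qed.

Lemma reduced_aut_word g v t : reduced t -> reduced (aut_word g v t).
Proof.
elim: t => // a [|b t] IH // rab; have := IH (reduced_cons rab).
rewrite /reduced /= => ->; rewrite andbT; apply/eqP => ab.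
case/andP: rab => /eqP nab _; apply: nab; apply: (@nbr_inj (node v (b :: t))).
apply: (@aut_inj g); rewrite aut_nbr /= ab nbrK.
by rewrite aut_nbr nbrK.
Qed.

Lemma dist_aut g x y : dist (g x) (g y) = dist x y.
Proof.
rewrite -{1}(node_word x y) aut_node dist_node ?size_aut_word//.
exact/reduced_aut_word/reduced_word.
Qed.

Lemma finite_ball v r : exists l : seq T, forall x, dist v x <= r -> x \in l.
Proof.
elim: r => [|r [l lP]].
  by exists [:: v] => x; rewrite leqn0 inE => /eqP/dist0 ->.
exists (l ++ [seq nbr x a | x <- l, a <- enum 'I_d]) => x.
rewrite mem_cat leq_eqVlt => /orP[|]; last by move=> /lP ->.
move=> /eqP xr; apply/orP; right; move: (node_word v x) xr.
rewrite /dist; case: (word v x) (reduced_word v x) => //= a t rat <- [tr].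
apply: allpairs_f; last exact: mem_enum.
by apply: lP; rewrite dist_node ?tr//; exact: reduced_cons rat.
Qed.

(** * Rays and translations *)

Implicit Types r : nat -> T.

(** A path without backtracking; in a tree it is a geodesic ([ray_dist]). *)
Definition ray r := forall i, adj (r i) (r i.+1) /\ r i.+2 <> r i.

Lemma ray_shift r k : ray r -> ray (fun i => r (i + k)).
Proof. by move=> rr i; exact: rr. Qed.

Lemma ray_node r n : ray r ->
  exists a t, [/\ reduced (a :: t), size t = n, node (r 0) t = r n &
    node (r 0) (a :: t) = r n.+1].
Proof.
move=> rr; elim: n => [|n [a [t [rt tn tE aE]]]].
  by have [/adj_nbrP[a aE] _] := rr 0; exists a, [::].
have [/adj_nbrP[b bE] _] := rr n.+1; exists b, (a :: t).
rewrite /= -[nbr _ a]/(node (r 0) (a :: t)) aE; split=> //.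
- rewrite /reduced /=; apply/andP; split=> //.
  apply/eqP => ba; apply: (proj2 (rr n)).
  by rewrite bE -aE ba /= nbrK.
- by rewrite tn.
Qed.

Lemma ray_dist r i n : ray r -> dist (r i) (r (i + n)) = n.
Proof.
move=> /(ray_shift i) /(ray_node n)[a [t [rt tn /= tE _]]].
by rewrite addnC -tE add0n dist_node//; exact: reduced_cons rt.
Qed.

(** The vertex at distance [m] from [v] on the geodesic from [v] to [x], which
    is [x] itself when [m] is at least the length of this geodesic. *)
Definition anc v m x := node v (drop (dist v x - m) (word v x)).

Lemma anc_id v m x : dist v x <= m -> anc v m x = x.
Proof. by move=> xm; rewrite /anc (eqP xm) drop0 node_word. Qed.

Lemma anc_nbr v m x a : m < dist v x -> anc v m (nbr x a) = anc v m x.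
Proof.
rewrite /anc /dist word_nbr; case: (word v x) => //= b t mt.
have [_|_] := eqVneq a b; first by rewrite subSn.
by rewrite /= !subSn ?(ltnW mt) //=.
Qed.

(** On the way from [x] to [y], only the part of the geodesic from the root
    that is at most [dist x y] away from its end can change. *)
Lemma anc_close v m x y : m + dist x y <= dist v x -> anc v m x = anc v m y.
Proof.
rewrite -{2}(node_word x y) /(dist x y).
elim: (word x y) => //= a t IH mx.
rewrite anc_nbr; first by apply: IH; lia.
have := dist_triangle (node x t) v x; rewrite (dist_sym (node x t) x).
have := dist_node_le x t; lia.
Qed.

Lemma anc_ray r m i : ray r -> m <= i -> anc (r 0) m (r i) = r m.
Proof.
move=> rr mi; have dr j : dist (r 0) (r j) = j by exact: (@ray_dist r 0).
rewrite (@anc_close _ _ _ (r m)) ?anc_id ?dr// dist_sym.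
by have := ray_dist m (i - m) rr; rewrite subnKC// => ->; rewrite subnKC.
Qed.

(** Far out, a point of one ray and a point of the other are so close, compared
    with their depth, that the geodesics to them share their first [m] edges. *)
Lemma ray_eq r r' : ray r -> ray r' -> r 0 = r' 0 ->
  (forall m, exists i j, m + dist (r i) (r' j) <= i) -> r =1 r'.
Proof.
move=> rr rr' r0 H m; have [i [j ij]] := H m.
have dr k : dist (r 0) (r k) = k by exact: (@ray_dist r 0).
have dr' k : dist (r' 0) (r' k) = k by exact: (@ray_dist r' 0).
rewrite -(@anc_ray r m i)//; last by lia.
rewrite (@anc_close _ _ _ (r' j)) ?dr// r0 anc_ray//.
have := dist_triangle (r' j) (r 0) (r i); rewrite dr r0 dr' dist_sym; lia.
Qed.

(** The path from the origin of the ray to [v] is treated edge by edge: the new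
    vertex is put in front of the ray, or the first vertex is dropped when this
    would backtrack. *)
Lemma ray_from r v : ray r ->
  exists r', [/\ ray r', r' 0 = v & exists p q, forall i, r' (i + p) = r (i + q)].
Proof.
move=> rr; rewrite -(node_word (r 0) v).
elim: (word (r 0) v) => /= [|a t [r' [rr' r'0 [p [q pq]]]]].
  by exists r; split=> //; exists 0, 0.
have [r'1|r'1] := eqVneq (r' 1) (nbr (node (r 0) t) a).
  exists (fun i => r' i.+1); split; [by move=> i; exact: rr' | by [] |].
  by exists p, q.+1 => i; rewrite -addSn pq addSnnS.
exists (fun i => if i is j.+1 then r' j else nbr (node (r 0) t) a).
split=> //; last by exists p.+1, q => i; rewrite addnS.
case=> [|i]; last exact: rr'.
by rewrite r'0 adj_sym adj_nbr; split=> //; apply/eqP.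
Qed.

(** The geodesic from a vertex [v] of least displacement to [g v] and its
    translates form a ray. If it backtracked at [g v], then the neighbour of [v]
    on this geodesic would have a smaller displacement or, when the displacement
    is 1, [g] would exchange [v] and [g v]. *)
Lemma translation_ray g : (forall v, g (g v) <> v) ->
  exists r l, [/\ ray r, 0 < l & forall i, g (r i) = r (i + l)].
Proof.
move=> nfix; have [v0 _] := vertex_nonempty T.
pose P n := `[< exists v, dist v (g v) = n >].
have exP : exists n, P n by exists (dist v0 (g v0)); apply/asboolP; exists v0.
have [l /asboolP[v vl] lmin] := ex_minnP exP.
have {}lmin z : l <= dist z (g z) by apply: lmin; apply/asboolP; exists z.
have l0 : 0 < l.
  by rewrite lt0n; apply/eqP => l0; apply: (nfix v); rewrite l0 in vl; rewrite -!(dist0 vl).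
pose t := word v (g v); have tl : size t = l by exact: vl.
pose p i := node v (drop (l - i) t).
have p0 : p 0 = v by rewrite /p subn0 -tl drop_size.
have pl : p l = g v by rewrite /p subnn drop0 node_word.
have pS i : i < l -> exists2 a, drop (l - i.+1) t = a :: drop (l - i) t &
    p i.+1 = nbr (p i) a.
  move=> il; case Ea : (drop (l - i.+1) t) => [|a t'].
    by move/(congr1 size) : Ea; rewrite size_drop tl /=; lia.
  have dE : t' = drop (l - i) t.
    have -> : l - i = 1 + (l - i.+1) by lia.
    by rewrite -drop_drop Ea /= drop0.
  by exists a; rewrite /p ?Ea -dE.
pose r i := iter (i %/ l) g (p (i %% l)).
have rE q i : i <= l -> r (q * l + i) = iter q g (p i).
  rewrite leq_eqVlt => /orP[/eqP ->|il].
    have -> : q * l + l = q.+1 * l by rewrite mulSnr.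
    by rewrite pl /r mulnK// modnMl p0 iterSr.
  by rewrite /r divnMDl// modnMDl divn_small// modn_small// addn0.
have adjr q x y : adj (iter q g x) (iter q g y) = adj x y.
  by elim: q => //= q <-; rewrite aut_adj.
have ginj q : injective (iter q g).
  by elim: q => // q IH x y /= /aut_inj /IH.
exists r, l; split=> // i; rewrite (divn_eq i l); have := ltn_pmod i l0.
  move: (i %/ l) (i %% l) => q j jl; rewrite -!addnS (rE q j) ?(ltnW jl)// (rE q j.+1)//.
  have [a aE pa] := pS _ jl; split; first by rewrite adjr pa adj_nbr.
  have [j2|j2] := ltnP j.+1 l.
    rewrite rE// => /ginj.
    have [b bE pb] := pS _ j2; rewrite pb pa => jj.
    have : reduced (b :: a :: drop (l - j) t).
      by rewrite -aE -bE; apply: reduced_drop; exact: reduced_word.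
    move=> /andP[/eqP + _]; apply; apply: (@nbr_inj (nbr (p j) a)).
    by rewrite jj nbrK.
  have jE : j.+1 = l by lia.
  have -> : q * l + j.+2 = q.+1 * l + 1 by rewrite mulSnr; lia.
  rewrite rE// iterSr => /ginj gp.
  have [l1|l1] := leqP l 1.
    have l1' : l = 1 by lia.
    apply: (nfix v); rewrite -pl l1' gp (_ : j = 0) ?p0//; lia.
  have dp k : k.+1 <= l -> dist (p 1) (p k.+1) <= k.
    elim: k => [|k IH] kl; first by rewrite distxx.
    have [b _ ->] := pS _ kl; apply: leq_trans (dist_nbr_le _ _ _) _.
    by rewrite ltnS IH// ltnW.
  (* Backtracking makes g (p 1) = p (l - 1), at distance at most l - 2. *)
  have j1 : j = (l - 2).+1 by lia.
  have := lmin (p 1); rewrite gp j1 => /leq_trans/(_ (dp _ _)); lia.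
move: (i %/ l) (i %% l) => q j jl; rewrite rE ?(ltnW jl)//.
have -> : q * l + j + l = q.+1 * l + j by rewrite mulSnr; lia.
by rewrite rE ?(ltnW jl).
Qed.
End ColouredTree.

(** * Large orbits of the universal group of a 2-transitive group *)

Section HalfTree.
Variables (d : nat) (T : regular_tree d) (c : legal_colouring T).
Implicit Types (x y z v : T) (a b e : 'I_d) (p q s t : seq 'I_d).

Section Twist.
Variables (v : T) (p : seq 'I_d).

Definition twist_word (f : 'S_d) t :=
  if suffix p t then map f (take (size t - size p) t) ++ p else t.

Lemma twist_wordE (f : 'S_d) q : twist_word f (q ++ p) = map f q ++ p.
Proof.
by rewrite /twist_word suffix_suffix size_cat addnK take_size_cat.
Qed.

Definition twist (f : 'S_d) x := node c v (twist_word f (word c v x)).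

Variables (a : 'I_d) (p' : seq 'I_d) (pE : p = a :: p').

Lemma reduced_map (f : 'S_d) q : f a = a -> reduced (q ++ p) ->
  reduced (map f q ++ p).
Proof.
move=> fa; rewrite pE; elim: q => // b [|b' q] IH /= /andP[bb' rq].
  by rewrite /reduced /= rq andbT -{1}fa (inj_eq perm_inj).
by rewrite /reduced /= (inj_eq perm_inj) bb'; exact: IH.
Qed.

Lemma reduced_twist_word (f : 'S_d) t : f a = a -> reduced t ->
  reduced (twist_word f t).
Proof.
move=> fa; rewrite /twist_word; case: ifP => // /suffixP[q ->].
by rewrite size_cat addnK take_size_cat//; exact: reduced_map.
Qed.

Lemma twistK (f : 'S_d) : f a = a -> cancel (twist f) (twist f^-1).
Proof.
move=> fa x; rewrite /twist wordK; last exact/reduced_twist_word/reduced_word.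
rewrite -[RHS](node_word c v x); congr (node _ _ _).
rewrite {2}/twist_word; case: ifP => [/suffixP[q ->]|nx]; last first.
  by rewrite /twist_word nx.
rewrite size_cat addnK take_size_cat// twist_wordE -map_comp.
by rewrite map_id_in// => b _ /=; rewrite permK.
Qed.

Lemma twist_nbr (f : 'S_d) x e : f a = a ->
  twist f (nbr c x e) =
  nbr c (twist f x) (if suffix p (word c v x) then f e else e).
Proof.
move=> fa; rewrite /twist word_nbr.
case: (boolP (suffix p _)) => [/suffixP[q qE]|np]; last first.
  rewrite {2}/twist_word (negbTE np) node_word.
  have ne : ~~ suffix p (e :: word c v x) -> node c v (twist_word f
      (e :: word c v x)) = nbr c x e.
    by move=> ns; rewrite /twist_word (negbTE ns) /= node_word.
  have {}ne : node c v (twist_word f (e :: word c v x)) = nbr c x e.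
    have [/suffixP[[|b q]]|//] := boolP (suffix p (e :: word c v x)).
      move=> /= eE; rewrite eE -[X in twist_word f X]/([::] ++ p) twist_wordE /=.
      by rewrite -eE /= node_word.
    by move=> [_ qE]; move: np; rewrite qE suffix_suffix.
  case wE : (word c v x) ne np => [|b t] // ne np.
  case: eqVneq => [eb|//].
  have : ~~ suffix p t by apply: contra np => /suffixP[q ->]; rewrite -cat_cons suffix_suffix.
  rewrite /twist_word => /negbTE ->.
  by rewrite -[in RHS](node_word c v x) wE /= eb nbrK.
rewrite {}qE twist_wordE; case: q => [|b q] /=.
  rewrite pE /=; case: eqVneq => [->|ea].
    rewrite fa nbrK /twist_word ifF// pE; apply/negP => /suffixP[q].
    by move=> /(congr1 size); rewrite size_cat /=; lia.
  by rewrite -[e :: a :: p']/([:: e] ++ a :: p') -pE twist_wordE pE.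
case: eqVneq => [->|eb]; first by rewrite nbrK twist_wordE.
by rewrite -[e :: _]/([:: e, b & q] ++ p) twist_wordE.
Qed.

Lemma twist_adj (f : 'S_d) x y : f a = a ->
  adj (twist f x) (twist f y) = adj x y.
Proof.
have H (k : 'S_d) x' y' : k a = a -> adj x' y' -> adj (twist k x') (twist k y').
  by move=> ka /(adj_nbrP c)[e ->]; rewrite twist_nbr// adj_nbr.
move=> fa; apply/idP/idP; last exact: H.
have fVa : (f^-1)%g a = a by rewrite -{1}fa permK.
by move=> /(H _ _ _ fVa); rewrite !twistK.
Qed.

End Twist.

(** Using [f] as the local action at every vertex behind the edge of colour [a]
    at [node v p], and the identity elsewhere, is consistent along this edge
    because [f] fixes [a]. *)
Lemma half_tree_twist (F : {group 'S_d}) (f : 'S_d) v a p :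
  f \in F -> f a = a -> exists u : Defs.aut T,
  [/\ universal_group c F u,
    forall x, dist c v x <= size p -> u x = x &
    forall q, reduced (q ++ a :: p) ->
      u (node c v (q ++ a :: p)) = node c v (map f q ++ a :: p)].
Proof.
move=> fF fa; have fVa : (f^-1)%g a = a by rewrite -{1}fa permK.
have K1 := twistK v (erefl (a :: p)) fa.
have K2 : cancel (twist v (a :: p) f^-1) (twist v (a :: p) f).
  by have := twistK v (erefl (a :: p)) fVa; rewrite invgK.
exists (Defs.Aut K1 K2 (fun x y => twist_adj v (erefl (a :: p)) x y fa)).
split=> [x|x xp|q rq].
- set u := Defs.Aut _ _ _.
  suff: local_action c u x \in [:: f; 1%g].
    by rewrite !inE => /orP[] /eqP -> //; exact: group1.
  have uE e : local_fun c u x e = if suffix (a :: p) (word c v x) then f e else e.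
    apply: (@nbr_inj _ _ c (u x)); rewrite -aut_nbr /=.
    exact: (twist_nbr v (erefl (a :: p)) x e fa).
  case: (suffix _ _) uE => uE; rewrite !inE; apply/orP; [left|right]; apply/eqP/permP => e.
    by rewrite permE uE.
  by rewrite permE perm1 uE.
- rewrite /= /twist /twist_word ifF ?node_word//; apply/negP => /suffixP[q].
  by move=> /(congr1 size); move: xp; rewrite /dist size_cat /=; lia.
- by rewrite /= /twist wordK// twist_wordE.
Qed.

Variables (F : {group 'S_d}) (F2 : two_transitive F).

(** The letters are corrected one at a time, beginning with the one nearest to
    the root. By 2-transitivity, some [f] in F changes this letter as required
    and fixes the preceding one; it also changes the letters further away, which
    are treated afterwards. *)
Lemma universal_transitive v q q' a p : size q = size q' ->
  reduced (q ++ a :: p) -> reduced (q' ++ a :: p) ->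
  exists u : Defs.aut T,
  [/\ universal_group c F u,
    forall x, dist c v x <= size p -> u x = x &
    u (node c v (q ++ a :: p)) = node c v (q' ++ a :: p)].
Proof.
move Eq: (size q) => n; elim: n q q' a p Eq => [|n IH] q q' a p.
  by case: q q' => // -[] // _ _ _; exists 1%g; split=> //; exact: universal_group1.
case/lastP: q => // q b; case/lastP: q' => [|q' b']; rewrite ?size_rcons //.
move=> -[sq] [sq'] rq rq'.
have ba s e : reduced (rcons s e ++ a :: p) -> a != e.
  rewrite cat_rcons => /(@drop_sorted _ _ (size s) _).
  by rewrite drop_size_cat //= eq_sym => /andP[].
have [f fF [fa fb]] := F2 (ba _ _ rq) (ba _ _ rq').
have [u1 [u1F u1f u1q]] := half_tree_twist v p fF fa.
have [||||u2 [u2F u2f u2q]] := IH (map f q) q' b' (a :: p).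
- by rewrite size_map.
- exact: esym.
- have := reduced_map (erefl (a :: p)) fa rq.
  by rewrite map_rcons fb cat_rcons.
- by rewrite -cat_rcons.
exists (u2 * u1)%g; split.
- exact: universal_groupM.
- by move=> x xp; rewrite autME u1f// u2f//= (leq_trans xp).
- by rewrite autME u1q// map_rcons fb !cat_rcons.
Qed.

(** A reduced word has at least two reduced extensions by one letter. *)
Lemma many_words a p n : 2 < d -> reduced (a :: p) ->
  exists L : seq (seq 'I_d), [/\ uniq L, size L = 2 ^ n &
    {in L, forall q, size q = n /\ reduced (q ++ a :: p)}].
Proof.
move=> d3 rp.
have /choice[e eP] : forall b : 'I_d, exists e : 'I_d * 'I_d,
    [/\ e.1 != b, e.2 != b & e.1 != e.2].
  move=> b.
  have : 1 < #|predC1 b| by rewrite cardC1 card_ord; lia.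
  by case/card_gt1P => x [y []]; rewrite !inE => xb yb xy; exists (x, y).
elim: n => [|n [L [uL sL LP]]].
  by exists [:: [::]]; split=> // q; rewrite inE => /eqP ->.
pose hd q := head a (q ++ a :: p).
pose f1 q := (e (hd q)).1 :: q; pose f2 q := (e (hd q)).2 :: q.
exists (map f1 L ++ map f2 L); split.
- rewrite cat_uniq !map_inj_uniq ?uL; try by move=> ? ? [].
  rewrite andbT /=; apply/hasPn => _ /mapP[q qL ->]; apply/mapP => -[q' q'L].
  rewrite /f1 /f2 => -[+ qq]; rewrite qq => E.
  by have [_ _ /eqP] := eP (hd q'); case.
- by rewrite size_cat !size_map sL expnS mul2n addnn.
- have rh q b : reduced (q ++ a :: p) -> b != hd q -> reduced (b :: q ++ a :: p).
    by rewrite /hd; case: q => [|b' q] /= rq bh; apply/andP.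
  move=> q; rewrite mem_cat => /orP[] /mapP[q' /LP[sq rq] ->] /=;
    rewrite sq; split=> //; apply: rh => //; by have [] := eP (hd q').
Qed.

(** Outside of a ball that contains [s], the stabilizer of [s] in U(F) is
    transitive on the vertices at a given depth behind a given vertex. The
    exponent is a truncated difference, so that the bound is trivial inside the
    ball. *)
Lemma large_orbit v (s : seq T) : 2 < d -> exists r, forall x,
  exists L : seq T, [/\ uniq L, size L = 2 ^ (dist c v x - r) &
    {in L, forall y, exists u : Defs.aut T,
      [/\ universal_group c F u, {in s, forall z, u z = z} & u x = y]}].
Proof.
move=> d3; pose r := (\max_(z <- s) dist c v z).+1; exists r => x.
have [xr|xr] := leqP (dist c v x) r.
  exists [:: x]; split=> //; first by rewrite (eqP xr).
  move=> y; rewrite inE => /eqP ->; exists 1%g; split=> //.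
  exact: universal_group1.
set n := dist c v x - r; set w := word c v x.
have rw : reduced w := reduced_word _ _ _.
have sw : size w = n + r by rewrite /n subnK// ltnW.
case pE : (drop n w) => [|a p].
  by move/(congr1 size): pE; rewrite size_drop sw /= /r; lia.
have sp : size (a :: p) = r by rewrite -pE size_drop sw; lia.
have wE : w = take n w ++ a :: p by rewrite -pE cat_take_drop.
have rp : reduced (a :: p) by rewrite -pE; exact: reduced_drop.
have [L [uL sL LP]] := many_words n d3 rp.
exists [seq node c v (q ++ a :: p) | q <- L]; split.
- rewrite map_inj_in_uniq// => q q' /LP[sq rq] /LP[sq' rq'] /(node_inj rq rq').
  by move/eqP; rewrite eqseq_cat// ?sq// => /andP[/eqP].
- by rewrite size_map.
- move=> _ /mapP[q /LP[sq rq] ->].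
  have st : size (take n w) = n by rewrite size_take sw; case: ltnP; lia.
  have [||u [uF uf uq]] := @universal_transitive v (take n w) q a p _ _ rq.
  + by rewrite st.
  + by rewrite -wE.
  exists u; split=> //; last by rewrite -uq -wE node_word.
  move=> z zs; apply: uf; move: sp => [->].
  exact: (leq_bigmax_seq (F := dist c v)).
Qed.

End HalfTree.

(** * Indices of compact open subgroups and the scale *)

Section CosetIndex.
Variable G : groupType.
Implicit Types (U V W : set G) (g u : G) (L : seq G).

Lemma subgroupV U u : is_subgroup U -> U u -> U u^-1%g.
Proof. by move=> [U1 UM] Uu; rewrite -(mul1g u^-1%g); exact: UM. Qed.

Lemma subgroupM U u v : is_subgroup U -> U u -> U v -> U (u * v)%g.
Proof. by move=> sU Uu Uv; rewrite -(invgK v); apply: sU.2 => //; exact: subgroupV. Qed.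

Lemma subgroupI U V : is_subgroup U -> is_subgroup V -> is_subgroup (U `&` V).
Proof.
by move=> [U1 UM] [V1 VM]; split=> // x y [Ux Vx] [Uy Vy]; split; [exact: UM|exact: VM].
Qed.

Lemma conjsetP g U u : conjset g U u <-> U (g^-1 * u * g)%g.
Proof.
split=> [[v Uv <-]|Uu]; first by rewrite !mulgA mulVg mul1g mulgKV.
by exists (g^-1 * u * g)%g => //; rewrite !mulgA mulgV mul1g mulgK.
Qed.

Lemma conjset1 U : conjset 1%g U = U.
Proof. by apply/seteqP; split=> u; rewrite conjsetP invg1 mul1g mulg1. Qed.

Lemma conjsetM g h U : conjset (g * h)%g U = conjset g (conjset h U).
Proof. by apply/seteqP; split=> u; rewrite !conjsetP invgM !mulgA. Qed.

Lemma conjset_subgroup g U : is_subgroup U -> is_subgroup (conjset g U).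
Proof.
move=> [U1 UM]; split; first by apply/conjsetP; rewrite mulg1 mulVg.
move=> x y /conjsetP Ux /conjsetP Uy; apply/conjsetP.
have := UM _ _ Ux Uy; congr (U _).
by rewrite !invgM invgK !mulgA mulgK.
Qed.

Lemma conjset_id g U : is_subgroup U -> U g -> conjset g U = U.
Proof.
move=> sU Ug; apply/seteqP; split=> u; rewrite conjsetP => Uu.
  have := subgroupM sU (subgroupM sU Ug Uu) (subgroupV sU Ug).
  by rewrite !mulgA mulgV mul1g mulgK.
by do !apply: subgroupM => //; exact: subgroupV.
Qed.

(** The translating elements need not be in U. Bounds on indices become
    statements about such coverings, which are easy to conjugate and compose. *)
Definition covered U V L := forall u, U u -> exists2 l, l \in L & V (l^-1 * u)%g.

Definition cosets U W := [set [set (u * w)%g | w in W] | u in U].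

Lemma coset_eq W u v : is_subgroup W ->
  [set (u * w)%g | w in W] = [set (v * w)%g | w in W] <-> W (u^-1 * v)%g.
Proof.
move=> sW; split=> [E|Wuv].
  have : [set (v * w)%g | w in W] v by exists 1%g; [exact: sW.1|rewrite mulg1].
  by rewrite -E => -[w Ww <-]; rewrite mulgA mulVg mul1g.
apply/seteqP; split=> _ [w Ww <-].
  exists ((u^-1 * v)^-1 * w)%g; first by apply: subgroupM => //; exact: subgroupV.
  by rewrite invgM invgK !mulgA mulgV mul1g.
by exists (u^-1 * v * w)%g; [exact: subgroupM | rewrite !mulgA mulgV mul1g].
Qed.

(** Two elements of U in one coset of V are in one coset of the intersection of
    U and V. *)
Lemma covered_cosets U V L : is_subgroup U -> is_subgroup V ->
  covered U V L -> exists f : G -> set G,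
    forall C, cosets U (U `&` V) C -> C \in map f L.
Proof.
move=> sU sV cov.
have /choice[f fP] : forall l, exists C : set G, forall u, U u -> V (l^-1 * u)%g ->
    C = [set (u * w)%g | w in U `&` V].
  move=> l; have [[u Uu Vu]|no] := pselect (exists2 u, U u & V (l^-1 * u)%g).
    exists [set (u * w)%g | w in U `&` V] => u' Uu' Vu'.
    apply/(coset_eq u u' (subgroupI sU sV)); split.
      by apply: subgroupM => //; exact: subgroupV.
    have := subgroupM sV (subgroupV sV Vu) Vu'.
    by rewrite invgM invgK !mulgA mulgK.
  by exists set0 => u Uu Vu; case: no; exists u.
exists f => _ [u Uu <-]; have [l lL Vu] := cov _ Uu.
by apply/mapP; exists l => //; rewrite (fP l u).
Qed.

Lemma finite_cosets U V L : is_subgroup U -> is_subgroup V ->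
  covered U V L -> finite_set (cosets U (U `&` V)).
Proof.
move=> sU sV /(covered_cosets sU sV)[f fP].
by apply: (@sub_finite_set _ _ [set` map f L]); [exact: fP | exact: finite_seq].
Qed.

Lemma coset_index_le U V L : is_subgroup U -> is_subgroup V ->
  covered U V L -> coset_index U (U `&` V) <= size L.
Proof.
move=> sU sV cov; have fin := finite_cosets sU sV cov.
have [f fP] := covered_cosets sU sV cov.
rewrite /coset_index -(size_map f) cardfE cardE -(size_map val).
apply: uniq_leq_size; first by rewrite map_inj_uniq ?enum_uniq//; exact: val_inj.
move=> C /mapP[[x xC] _ ->] /=; apply: fP.
by move: xC; rewrite in_fset_set// inE.
Qed.

Lemma coset_index_covered U V L0 : is_subgroup U -> is_subgroup V ->
  covered U V L0 -> exists2 L, size L = coset_index U (U `&` V) & covered U V L.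
Proof.
move=> sU sV cov; have fin := finite_cosets sU sV cov.
exists [seq xget 1%g C | C : set G <- enum_fset (fset_set (cosets U (U `&` V)))].
  by rewrite size_map.
move=> u Uu; set C := [set (u * w)%g | w in U `&` V].
have CC : C \in fset_set (cosets U (U `&` V)).
  by rewrite in_fset_set// inE; exists u.
exists (xget 1%g C); first exact: (map_f (xget 1%g)).
have : C (xget 1%g C).
  by apply: (@xgetPex _ 1%g C); exists u; exists 1%g; [split; [exact: sU.1|exact: sV.1]|rewrite mulg1].
move=> [w [_ Vw] <-]; rewrite invgM mulgKV; exact: subgroupV.
Qed.

Lemma covered_conj g U V L : covered U V L ->
  covered (conjset g U) (conjset g V) [seq (g * l * g^-1)%g | l <- L].
Proof.
move=> cov u /conjsetP /cov[l lL Vu]; exists (g * l * g^-1)%g; first exact: map_f.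
by apply/conjsetP; move: Vu; rewrite !invgM invgK !mulgA mulVg mul1g.
Qed.

Lemma covered_trans U V W L M : covered U V L -> covered V W M ->
  covered U W [seq (l * m)%g | l <- L, m <- M].
Proof.
move=> UV VW u /UV[l lL /VW[m mM Wu]]; exists (l * m)%g; first exact: allpairs_f.
by rewrite invgM -mulgA.
Qed.

End CosetIndex.

Section Compact.
Variable G : topologicalGroupType.
Implicit Types (K U V W : set G) (g : G).

Lemma mulg_continuousr (x : G) : continuous (fun y : G => (y * x)%g).
Proof.
move=> y; apply: (@continuous_comp _ _ _ (fun y => (y, x))
  (fun xy : G * G => (xy.1 * xy.2)%g)); last exact: mulg_continuous.
by apply: cvg_pair; [exact: cvg_id | exact: cvg_cst].
Qed.

Lemma open_translate g V : open V -> open [set u | V (g * u)%g].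
Proof. by move=> oV; have /continuousP := @mulg_continuousl G g; exact. Qed.

Lemma conj_continuous g : continuous (fun u : G => (g * u * g^-1)%g).
Proof.
move=> u; apply: (@continuous_comp _ _ _ (fun u => (g * u)%g) (fun u => (u * g^-1)%g)).
  exact: mulg_continuousl.
exact: mulg_continuousr.
Qed.

Lemma open_subgroup_closed U : is_subgroup U -> open U -> closed U.
Proof.
move=> sU oU; rewrite -openC openE => x nUx.
have xx : [set u | U (x^-1 * u)%g] x by rewrite /= mulVg; exact: sU.1.
move: (open_nbhs_nbhs (conj (open_translate x^-1 oU) xx)).
apply: filterS => u /= Uu Uu'; apply: nUx.
have := subgroupM sU Uu' (subgroupV sU Uu); rewrite invgM invgK mulgA mulgV mul1g.
by [].
Qed.

(** If there is no finite covering, the complements of the finite unions of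
    translates of V generate a filter on K; it has a cluster point x, but the
    neighbourhood x V of x misses the complement of x V. *)
Lemma compact_covered K V : compact K -> open V -> V 1%g ->
  exists L, covered K V L.
Proof.
move=> cK oV V1; apply: contrapT => noL.
pose B (L : seq G) := [set u | K u /\ forall l, l \in L -> ~ V (l^-1 * u)%g].
have BF : ProperFilter (filter_from setT B).
  apply: filter_from_proper; last first.
    move=> L _; apply: contrapT => B0; apply: noL; exists L => u Ku.
    apply: contrapT => nl; apply: B0; exists u; split=> // l lL Vl.
    by apply: nl; exists l.
  apply: filter_from_filter; first by exists [::].
  move=> L M _ _; exists (L ++ M) => // u [Ku uLM].
  by split; split=> // l lL; apply: uLM; rewrite mem_cat lL ?orbT.
have [|x [Kx clx]] := cK _ BF; first by exists [::] => // u [].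
have xx : [set u | V (x^-1 * u)%g] x by rewrite /= mulVg.
have xnb := open_nbhs_nbhs (conj (open_translate x^-1 oV) xx).
have xB : filter_from setT B (B [:: x]) by exists [:: x].
have [u [[_ ux] Vu]] := clx _ _ xB xnb.
by apply: (ux x); rewrite ?inE.
Qed.

Lemma COS_covered U V : COS U -> COS V -> exists L, covered U V L.
Proof. by move=> [_ _ cU] [sV oV _]; apply: compact_covered => //; exact: sV.1. Qed.

Lemma COS_conj g U : COS U -> COS (conjset g U).
Proof.
move=> [sU oU cU]; split.
- exact: conjset_subgroup.
- have /continuousP/(_ _ oU) := @conj_continuous g^-1%g.
  congr (open _); apply/seteqP; split=> u; rewrite conjsetP /= invgK; exact.
- exact: (continuous_compact (continuous_subspaceT (@conj_continuous g)) cU).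
Qed.

Lemma COS_index U V : COS U -> COS V ->
  exists2 L, size L = coset_index U (U `&` V) & covered U V L.
Proof.
move=> cU cV; have [L0 cov] := COS_covered cU cV.
have [sU _ _] := cU; have [sV _ _] := cV; exact: coset_index_covered cov.
Qed.

Lemma coset_index_gt0 U V : COS U -> COS V -> 0 < coset_index U (U `&` V).
Proof.
move=> cU cV; have [L <- cov] := COS_index cU cV.
have [sU _ _] := cU; have [l] := cov _ sU.1; by case: L {cov}.
Qed.

Lemma coset_index_conj g U V : COS U -> COS V ->
  coset_index (conjset g U) (conjset g U `&` conjset g V) <= coset_index U (U `&` V).
Proof.
move=> cU cV; have [L <- cov] := COS_index cU cV.
have [sU _ _] := cU; have [sV _ _] := cV.
rewrite -(size_map (fun l => g * l * g^-1)%g).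
apply: coset_index_le; [exact: conjset_subgroup..|exact: covered_conj].
Qed.

Lemma coset_index_trans U V W : COS U -> COS V -> COS W ->
  coset_index U (U `&` W) <= coset_index U (U `&` V) * coset_index V (V `&` W).
Proof.
move=> cU cV cW; have [L <- covL] := COS_index cU cV.
have [M <- covM] := COS_index cV cW.
have [sU _ _] := cU; have [sW _ _] := cW.
rewrite -(size_allpairs (fun l m => l * m)%g L M).
by apply: coset_index_le => //; exact: covered_trans covM.
Qed.

Lemma leastP (A : set nat) (n : nat) : A n -> A (least 0%N A) /\ least 0%N A <= n.
Proof.
move=> An.
have exA : exists n, `[< A n >] by exists n; apply/asboolP.
have [m /asboolP Am mmin] := ex_minnP exA.
have : [set m | A m /\ lbound A m] (least 0%N A).
  apply: (@xgetPex _ 0%N [set m | A m /\ lbound A m]); exists m; split=> //.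
  by move=> k /asboolP Ak; exact: mmin.
by move=> [Al lb]; split=> //; exact: lb.
Qed.

Lemma scale_gt0 g U : COS U -> 0 < scale g.
Proof.
move=> cU; have AU : [set coset_index (conjset g U) (conjset g U `&` U) | U in @COS G]
    (coset_index (conjset g U) (conjset g U `&` U)) by exists U.
have [[V cV E] _] := leastP AU; rewrite /scale -E.
by apply: coset_index_gt0 => //; exact: COS_conj.
Qed.

(** The index of [conjset g U] relative to U is 1. *)
Lemma normalized_not_towards g U : COS U -> conjset g U = U ->
  ~ towards_infinity g.
Proof.
move=> cU gU; rewrite /towards_infinity.
have AU : [set coset_index (conjset g U) (conjset g U `&` U) | U in @COS G]
    (coset_index (conjset g U) (conjset g U `&` U)) by exists U.
have [_ ] := leastP AU; rewrite -/(scale g) gU => sg.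
have : coset_index U (U `&` U) <= 1.
  have [sU _ _] := cU; apply: (@coset_index_le _ U U [:: 1%g]) => // u Uu.
  by exists 1%g; rewrite ?inE// invg1 mul1g.
by move=> le1; apply/negP; rewrite -leqNgt (leq_trans sg).
Qed.

End Compact.

(** * Where two elements of G(F,F') differ *)

Section Difference.
Variables (d : nat) (T : regular_tree d) (c : legal_colouring T).
Variables (F F' : {group 'S_d}) (sFF' : F \subset F').
Local Notation G := (GFF c sFF').
Local Notation dist := (dist c).
Implicit Types (v x y z : T).

(** The vertices where the local actions of the inverses of [a] and [b] differ
    modulo F. Inverses are used so that [diff a b] depends only on the left
    cosets of U(F) ([diff_universal]) and moves along with left translations
    ([diff_mul]). *)
Definition diff (a b : Defs.aut T) : set T :=
  [set z | ((local_action c a^-1 z)^-1 * local_action c b^-1 z)%g \notin F].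

Lemma diff_sym a b z : diff a b z -> diff b a z.
Proof. by rewrite /diff /= -groupV invgM invgK. Qed.

Lemma diff_triangle b a e z : diff a e z -> diff a b z \/ diff b e z.
Proof.
rewrite /diff /= => ae; apply: contrapT => /not_orP[].
move=> /negP + /negP; rewrite !negbK => ab be; move: ae; apply/negP; rewrite negbK.
by have := groupM ab be; rewrite mulgA mulgK.
Qed.

Lemma diff_mul u a b z : diff (u * a)%g (u * b)%g z <-> diff a b (u^-1%g z).
Proof.
rewrite /diff /= !invgM !local_actionM invgM.
by rewrite mulgA mulgKV.
Qed.

Lemma diff_universal a b t z : universal_group c F t ->
  diff a (b * t)%g z <-> diff a b z.
Proof.
move=> tF; rewrite /diff /= invgM local_actionM mulgA groupMr//.
exact: universal_groupV.
Qed.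

Lemma diff1 a z : diff 1%g a z <-> local_action c a^-1 z \notin F.
Proof. by rewrite /diff /= invg1 local_action1 invg1 mul1g. Qed.

Lemma diff1_universal t z : universal_group c F t -> ~ diff 1%g t z.
Proof. by move=> /universal_groupV tF /diff1; rewrite tF. Qed.

Lemma diff_finite (g : G) : exists A : seq T, forall z, diff 1%g g z -> z \in A.
Proof.
have /asboolP[_ /finite_seqP[A AE]] := GFF_valP (g^-1)%g.
exists A => z /diff1 nz.
by have : [set` A] z by rewrite -AE.
Qed.

Lemma valX (g : G) n : val (g ^+ n)%g = (val g ^+ n)%g.
Proof. by elim: n => [|n IH] //; rewrite !expgS -IH. Qed.

(** [g ^+ i] and [g ^+ j] can only differ at the translates, by the powers of
    [g] in between, of the places where [g] differs from the identity. *)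
Lemma diff_exp (g : Defs.aut T) i n z : diff (g ^+ i)%g (g ^+ (i + n))%g z ->
  exists2 t, i <= t < i + n & diff 1%g g ((g ^+ t)^-1%g z).
Proof.
elim: n => [|n IH].
  rewrite addn0 /diff /= mulVg group1 => //.
move=> /(diff_triangle (g ^+ (i + n))%g)[/IH[t /andP[it tn] gt]|].
  by exists t => //; rewrite it addnS ltnS ltnW.
rewrite addnS expgSr -[X in diff X _](mulg1 _) => /diff_mul gz.
by exists (i + n) => //; rewrite leq_addr ltnS /=.
Qed.

Lemma rep_seq (X : finType) (f : G -> X) (P : G -> Prop) :
  exists L : seq G, forall g, P g -> exists l, [/\ l \in L, P l & f l = f g].
Proof.
have /choice[r rP] : forall k : X, exists l, (exists2 g, P g & f g = k) ->
    P l /\ f l = k.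
  move=> k; have [[g Pg gk]|no] := pselect (exists2 g, P g & f g = k).
    by exists g.
  by exists 1%g.
exists [seq r k | k <- enum X] => g Pg.
have [Pl fl] : P (r (f g)) /\ f (r (f g)) = f g by apply: rP; exists g.
by exists (r (f g)); split=> //; apply: map_f; rewrite mem_enum.
Qed.

(** The elements that move [v] by a bounded distance and differ from the
    identity only near [v] form finitely many cosets of the stabilizer of a
    finite set: the coset is determined by the image of this set and by the
    finitely many local actions near [v]. *)
Lemma finitely_many_cosets v (s : seq T) r : exists L : seq G, forall g : G,
  dist v (g v) <= r -> (forall z, diff 1%g g z -> dist v z <= r) ->
  exists2 l, l \in L & GFF_stab s (l^-1 * g)%g.
Proof.
pose m := \max_(x <- s) dist v x.
have [B BP] := finite_ball c v r; have [B' B'P] := finite_ball c v (r + m).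
pose P (g : G) := dist v (g v) <= r /\ forall z, diff 1%g g z -> dist v z <= r.
pose f (g : G) := (map_tuple (fun x => inord (index (g x) B') : 'I_(size B').+1)
  (in_tuple s), map_tuple (fun z => local_action c (val g)^-1%g z) (in_tuple B)).
have [L LP] := rep_seq f P.
exists L => g gr gd; have [l [lL [lr ld] [fs fB]]] := LP g (conj gr gd).
exists l => //.
have {}fs : {in s, forall x, l x = g x}.
  move=> x xs; have /eq_in_map/(_ x xs) := fs.
  have inB (k : G) : dist v (k v) <= r -> k x \in B'.
    move=> kr; apply: B'P; apply: (leq_trans (dist_triangle c (k v) v (k x))).
    rewrite dist_aut leq_add//; exact: (leq_bigmax_seq (F := dist v)).
  move=> /(congr1 (@nat_of_ord _)); rewrite !inordK ?ltnS ?index_size//.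
  by move=> E; rewrite -(nth_index v (inB _ lr)) E nth_index// inB.
have {}fB : {in B, forall x, local_action c (val l)^-1%g x =
    local_action c (val g)^-1%g x} by apply/eq_in_map.
split=> [y|x xs]; last by rewrite GFF_valM -fs// GFF_mulVK.
rewrite -[val _]/((val l)^-1 * val g)%g local_actionM.
set z := (val g) y.
have -> : local_action c (val g) y = (local_action c (val g)^-1%g z)^-1%g.
  by rewrite local_actionV invgK /z -autME mulVg.
have [zr|zr] := leqP (dist v z) r; first by rewrite fB ?BP// mulVg group1.
have nd (k : G) : (forall z, diff 1%g k z -> dist v z <= r) ->
    local_action c (val k)^-1%g z \in F.
  move=> kd; apply/negPn/negP => /(proj2 (diff1 _ _))/kd; by rewrite leqNgt zr.
by rewrite groupM ?groupV ?nd.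
Qed.

Lemma COS_stab (U : set G) : COS U -> exists s, GFF_stab s `<=` U.
Proof.
move=> [sU oU _]; have : nbhs (1%g : G) U.
  by apply: open_nbhs_nbhs; split=> //; exact: sU.1.
move=> /nbhs_GFF[s sP]; exists s => b bs; apply: sP.
by exists b => //; rewrite mul1g.
Qed.

Lemma stab_subgroup s : is_subgroup (@GFF_stab _ _ c _ _ sFF' s).
Proof.
split; first by split=> //; exact: universal_group1.
by move=> x y xs ys; apply: GFF_stabM => //; exact: GFF_stabV.
Qed.

Lemma subgroup_open (K : set G) s : is_subgroup K -> GFF_stab s `<=` K -> open K.
Proof.
move=> sK Ks; rewrite openE => x Kx; apply/nbhs_GFF; exists s.
by move=> _ [b /Ks Kb <-]; exact: subgroupM.
Qed.

(** An open subgroup is closed, and closed subsets of finite unions of translates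
    of U are compact. This gives new compact open subgroups from a known one. *)
Lemma subgroup_COS (U K : set G) s L : COS U -> is_subgroup K ->
  GFF_stab s `<=` K -> covered K U L -> COS K.
Proof.
move=> [_ _ cU] sK sKs cov; have oK := subgroup_open sK sKs.
split=> //; apply: (@subclosed_compact _ K
  (\big[setU/set0]_(l <- L) [set (l * u)%g | u in U])).
- exact: open_subgroup_closed.
- apply: bigsetU_compact => l _.
  apply: (continuous_compact _ cU); apply: continuous_subspaceT.
  exact: mulg_continuousl.
- move=> k /cov[l lL Uk]; rewrite -bigcup_seq; exists l => //=.
  by exists (l^-1 * k)%g => //; rewrite mulgA mulgV mul1g.
Qed.

(** If [g] fixes [v], or exchanges [v] and [g v], then it normalizes the group of
    the elements that fix [v] and [g v] and whose local actions are in F outside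
    of the union of two large balls around [v] and [g v]. This group is compact
    by [finitely_many_cosets]. *)
Lemma towards_infinity_hyperbolic (U : set G) (g : G) : COS U ->
  towards_infinity g -> forall v, g (g v) <> v.
Proof.
move=> cU tg v gv; have [s sU] := COS_stab cU.
have [A AP] := diff_finite g; have [A' A'P] := diff_finite g^-1%g.
pose r := \max_(x <- A ++ A') dist v x.
pose B z := dist v z <= r \/ dist (g v) z <= r.
pose K := [set u : G | [/\ u v = v, u (g v) = g v & forall z, diff 1%g u z -> B z]].
have Ar x : x \in A ++ A' -> B x.
  by move=> xA; left; exact: (leq_bigmax_seq (F := dist v)).
have BK (u : G) z : K u -> B (u z) <-> B z.
  by move=> [uv ugv _]; rewrite /B -{1}uv -{1}ugv !dist_aut.
have Kstab : GFF_stab [:: v; g v] `<=` K.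
  move=> u [uF us]; split; [apply: us|apply: us|move=> z /diff1_universal[]//];
    by rewrite !inE eqxx ?orbT.
have sK : is_subgroup K.
  split; first by apply: Kstab; exact: (stab_subgroup _).1.
  move=> x y Kx Ky; have [xv xgv xd] := Kx; have [yv ygv yd] := Ky; split.
  - by rewrite GFF_valM -{1}yv GFF_mulVK.
  - by rewrite GFF_valM -{1}ygv GFF_mulVK.
  - move=> z; rewrite -[val _]/(val x * (val y)^-1)%g.
    move=> /(diff_triangle (val x))[/xd//|].
    rewrite -[X in diff X _](mulg1 _) => /diff_mul.
    rewrite -[X in diff X _](mulVg (val y)) -[X in diff _ X](mulg1 _).
    move=> /diff_mul/diff_sym/yd; rewrite invgK.
    move=> /(BK y _ Ky) Bz; rewrite -(GFF_mulKV x z); exact/(BK x _ Kx).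
have conjK (h : G) u : h v = g v -> h (g v) = v ->
    (forall z, diff 1%g h z -> B z) -> (forall z, diff 1%g h^-1%g z -> B z) ->
    K u -> K (h * u * h^-1)%g.
  move=> hv hgv hd hVd Ku; have [uv ugv ud] := Ku.
  have Bh z : B (h z) <-> B z.
    by rewrite /B -{1}hv -{1}hgv !dist_aut; split=> -[]; by [left|right].
  have hVv : h^-1%g v = g v by rewrite -[in LHS]hgv GFF_mulVK.
  have hVgv : h^-1%g (g v) = v by rewrite -[in LHS]hv GFF_mulVK.
  split; rewrite ?GFF_valM ?hVv ?hVgv ?uv ?ugv//.
  move=> z; rewrite -[val _]/(val h * val u * (val h)^-1)%g.
  move=> /(diff_triangle (val h))[/hd//|].
  rewrite -[X in diff X _](mulg1 _) -mulgA => /diff_mul.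
  move=> /(diff_triangle (val u))[/ud|].
    by rewrite -(Bh (h^-1 z)%g) GFF_mulKV.
  rewrite -[X in diff X _](mulg1 _) => /diff_mul/hVd Bz.
  rewrite -(GFF_mulKV h z); apply/Bh; rewrite -(GFF_mulKV u (h^-1%g z)).
  by apply/(BK u _ Ku).
have gKg : conjset g K = K.
  have gB z : diff 1%g g z -> B z by move=> /AP zA; apply: Ar; rewrite mem_cat zA.
  have gVB z : diff 1%g g^-1%g z -> B z.
    by move=> /A'P zA; apply: Ar; rewrite mem_cat zA orbT.
  have gVv : g^-1%g v = g v by rewrite -[in LHS]gv GFF_mulVK.
  apply/seteqP; split=> u.
    by move=> [k Kk <-]; exact: conjK.
  move=> Ku; apply/conjsetP; have := conjK (g^-1)%g u; rewrite invgK; apply=> //.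
  exact: GFF_mulVK.
have [L LP] := finitely_many_cosets v s (r + dist v (g v)).
have cK : COS K.
  apply: (subgroup_COS cU sK Kstab (L := L)) => u [uv _ ud].
  have [||l lL lu] := LP u; last by exists l => //; exact: sU.
    by rewrite uv distxx.
  move=> z /ud[zr|gzr]; first by rewrite (leq_trans zr)// leq_addr.
  by rewrite (leq_trans (dist_triangle c (g v) _ _))// addnC leq_add.
exact: normalized_not_towards cK gKg tg.
Qed.

(** If there are at most two colours, an element that fixes a vertex and its
    neighbours is trivial, so that G(F,F') is discrete. *)
Lemma towards_infinity_degree (U : set G) (g : G) : COS U ->
  towards_infinity g -> 2 < d.
Proof.
move=> cU tg; rewrite ltnNge; apply/negP => d2.
have [v _] := vertex_nonempty T.
pose s := v :: [seq nbr c v a | a <- enum 'I_d].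
have stab1 (u : G) : GFF_stab s u -> u = 1%g.
  move=> [_ us]; apply/val_inj/aut_ext => x.
  have fixn t : u (node c v t) = node c v t /\
      forall a, u (nbr c (node c v t) a) = nbr c (node c v t) a.
    elim: t => [|b t [ut ub]] /=.
      split=> [|a]; apply: us; first by rewrite inE eqxx.
      by rewrite inE map_f ?orbT// mem_enum.
    split=> // a; set y := nbr c _ b; have uy : u y = y by exact: ub.
    have yb : nbr c y b = node c v t by rewrite nbrK.
    have ubb : local_fun c u y b = b.
      by apply: (@nbr_inj _ _ c y); rewrite -{1}uy -aut_nbr yb.
    rewrite aut_nbr uy; congr (nbr c y _).
    have [->//|ab] := eqVneq a b.
    have : local_fun c u y a != b.
      by rewrite -[X in _ != X]ubb (inj_eq (@local_fun_inj _ _ c u y)).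
    move: (local_fun c u y a) ab => e ab eb; apply: val_inj => /=.
    move: ab eb; rewrite -!val_eqE /=; have := ltn_ord a; have := ltn_ord b.
    have := ltn_ord e; lia.
  by have [ux _] := fixn (word c v x); rewrite node_word in ux; exact: ux.
have sK := stab_subgroup s.
have s1 : GFF_stab s `<=` [set (1%g : G)] by move=> u /stab1.
have cK : COS (@GFF_stab _ _ c _ _ sFF' s).
  split=> //; first exact: (subgroup_open sK (s := s)).
  rewrite (_ : GFF_stab s = [set (1%g : G)]); first exact: compact_set1.
  by apply/seteqP; split=> // u ->; exact: sK.1.
apply: normalized_not_towards tg; first exact: cK.
apply/seteqP; split=> u; rewrite conjsetP => /s1 /=.
  move=> E; have -> : u = 1%g; last exact: sK.1.
  have := congr1 (fun k => g * k * g^-1)%g E.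
  by rewrite !mulgA mulgV mul1g mulgK mulg1 mulgV.
by move=> ->; rewrite mulg1 mulVg; exact: sK.1.
Qed.

End Difference.

(** * Counting orbits against indices *)

Section Counting.
Variables (d : nat) (T : regular_tree d) (c : legal_colouring T).
Variables (F F' : {group 'S_d}) (sFF' : F \subset F').
Hypotheses (F2 : two_transitive F) (d3 : 2 < d).
Local Notation G := (GFF c sFF').
Local Notation dist := (dist c).
Local Notation diff := (diff c F).
Implicit Types (v x y z : T).

Definition cindex (U V : set G) (a b : G) : nat :=
  coset_index (conjset a U) (conjset a U `&` conjset b V).

(** Here [E b] is a set of vertices attached to the coset of [b] modulo the
    stabilizer of [v], either the single vertex [b v] or the set [diff a b]. Let
    [u] be in [GFF_stab s]. The coset of [a u a^-1 b] is determined by a pair of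
    elements of [L] and [M], and [a u x] is in [E (a u a^-1 b)]. This set is the
    image of [E b] under [a u a^-1], hence has at most [size D] elements. *)
Lemma orbit_count (U V : set G) (a b : G) (s : seq T) v
    (L M : seq G) (D : seq T) (E : Defs.aut T -> set T) x (O : seq T) :
  GFF_stab s `<=` U -> covered (conjset a U) (conjset b V) L ->
  covered V (@GFF_stab _ _ c _ _ sFF' [:: v]) M ->
  (forall u : G, GFF_stab s u -> forall y,
     E (val a * val u * (val a)^-1 * val b)%g y -> exists2 z, z \in D & y = (a * u * a^-1)%g z) ->
  (forall u : G, GFF_stab s u -> E (val a * val u * (val a)^-1 * val b)%g (a (u x))) ->
  (forall (b' : Defs.aut T) (t : G), GFF_stab [:: v] t ->
     E (b' * val t)%g = E b') ->
  uniq O -> {in O, forall y, exists2 u : G, GFF_stab s u & u x = y} ->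
  size O <= size L * size M * size D.
Proof.
move=> sU covL covM ED Ex Et uO OP.
have /choice[f fP] : forall lm : G * G, exists f : seq T, size f = size D /\
    forall u t : G, GFF_stab s u -> GFF_stab [:: v] t ->
      (a * u * a^-1 * b = lm.1 * b * lm.2 * t)%g -> a (u x) \in f.
  move=> [l m] /=.
  have [[u [t [us ts utE]]]|no] := pselect (exists u t : G, [/\ GFF_stab s u,
      GFF_stab [:: v] t & (a * u * a^-1 * b = l * b * m * t)%g]); last first.
    exists D; split=> // u t us ts utE; case: no; by exists u, t.
  exists (map (a * u * a^-1)%g D); rewrite size_map; split=> // u' t' us' ts' utE'.
  have [|z zD ->] := ED u us (a (u' x)); last exact: map_f.
  have := Ex _ us'.
  have e : (val a * val u * (val a)^-1 * val b = val (l * b * m) * val t)%g.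
    exact: (congr1 val utE).
  have e' : (val a * val u' * (val a)^-1 * val b = val (l * b * m) * val t')%g.
    exact: (congr1 val utE').
  by rewrite e e' (Et _ _ ts) (Et _ _ ts').
rewrite -(size_map a).
have := @uniq_leq_size _ (map a O) (flatten [seq f lm | lm <- [seq (l, m) | l <- L, m <- M]]).
rewrite (_ : size (flatten _) = size L * size M * size D); last first.
  rewrite size_flatten /shape -map_comp -(size_allpairs pair L M).
  elim: [seq (l, m) | l <- L, m <- M] => //= lm S ->.
  by rewrite (fP lm).1 mulSn.
apply; first by rewrite map_inj_uniq//; exact: aut_inj.
move=> _ /mapP[y /OP[u us <-] ->].
have /covL[l lL] : conjset a U (a * u * a^-1)%g by exists u => //; exact: sU.
move=> /conjsetP/covM[m mM ts].
apply/flatten_mapP; exists (l, m); first exact: allpairs_f.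
apply: (proj2 (fP (l, m)) u _ us ts) => /=.
by rewrite !mulgA !mulgK mulgV mul1g.
Qed.

Lemma stab_covered (V : set G) v : COS V ->
  exists M, covered V (@GFF_stab _ _ c _ _ sFF' [:: v]) M.
Proof.
move=> [_ _ cV]; have sK := @stab_subgroup _ _ c _ _ sFF' [:: v].
apply: compact_covered => //; last exact: sK.1.
exact: (subgroup_open sK (s := [:: v])).
Qed.

Lemma stab_large_orbit v (s : seq T) : exists r, forall x, exists O : seq T,
  [/\ uniq O, size O = 2 ^ (dist v x - r) &
    {in O, forall y, exists2 u : G, GFF_stab s u & u x = y}].
Proof.
have [r rP] := large_orbit c F2 v s d3; exists r => x.
have [O [uO sO OP]] := rP x; exists O; split=> // y /OP[u [uF us ux]].
by exists (@MkGFF _ _ c F F' sFF' u (universal_groupP sFF' uF)).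
Qed.

Lemma vertex_bound (U V : set G) v : COS U -> COS V -> exists C, forall a b : G,
  2 ^ dist (a v) (b v) <= C * cindex U V a b.
Proof.
move=> cU cV; have [s sU] := COS_stab cU; have [M covM] := stab_covered v cV.
have [r rP] := stab_large_orbit v s.
exists (2 ^ r * size M) => a b.
have [L sL covL] := COS_index (COS_conj a cU) (COS_conj b cV).
rewrite /cindex -sL; set x := (a^-1 * b)%g v.
have -> : dist (a v) (b v) = dist v x.
  by rewrite -[RHS](dist_aut c a) -GFF_valM mulgA mulgV mul1g.
have [O [uO sO OP]] := rP x.
have : size O <= size L * size M * size [:: b v].
  apply: (@orbit_count U V a b s v L M _ (fun b' => [set b' v]) x) => //.
  - by move=> u us y /= ->; exists (b v); rewrite ?inE.
  - move=> b' t [_ ts]; rewrite (_ : (b' * val t)%g v = b' v)//.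
    by rewrite -[LHS]/(b' (t v)) ts// inE.
rewrite sO muln1 => le.
rewrite (leq_trans (n := 2 ^ r * 2 ^ (dist v x - r)))//.
  by rewrite -expnD leq_exp2l//; lia.
by rewrite -mulnA leq_mul2l (mulnC (size M)) le orbT.
Qed.

Lemma diff_bound (U V : set G) v : COS U -> COS V -> exists C,
  forall (a b : G) (D : seq T), (forall z, diff a b z -> z \in D) ->
  forall z, diff a b z -> 2 ^ dist (a v) z <= C * cindex U V a b * size D.
Proof.
move=> cU cV; have [s sU] := COS_stab cU; have [M covM] := stab_covered v cV.
have [r rP] := stab_large_orbit v s.
exists (2 ^ r * size M) => a b D DP z dz.
have [L sL covL] := COS_index (COS_conj a cU) (COS_conj b cV).
rewrite /cindex -sL; set x := (a^-1)%g z.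
have -> : dist (a v) z = dist v x by rewrite -[RHS](dist_aut c a) /x GFF_mulKV.
have [O [uO sO OP]] := rP x.
(* Conjugates by a of elements of U(F) preserve the coset a U(F), so they only
   move the second argument of diff. *)
have shift (u : G) y : GFF_stab s u ->
    diff a (val a * val u * (val a)^-1 * val b)%g y <->
    diff a b ((a * u * a^-1)^-1 y)%g.
  move=> [us _]; set w := (val a * val u * (val a)^-1)%g.
  have wa : (w * val a = val a * val u)%g by rewrite /w -!mulgA mulVg mulg1.
  rewrite -[X in _ <-> diff _ _ X]/(w^-1%g y) -diff_mul wa.
  by split=> /diff_sym h; apply: diff_sym; apply/(diff_universal _ _ _ us).
have : size O <= size L * size M * size D.
  apply: (@orbit_count U V a b s v L M _ (diff a) x) => //.
  - move=> u us y /(shift u y us)/DP; set w := (a * u * a^-1)%g => wD.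
    by exists (w^-1 y)%g; rewrite ?GFF_mulKV.
  - move=> u us; apply/(shift u _ us).
    by rewrite -[a (u x)]/((a * u * a^-1)%g z) GFF_mulVK.
  - by move=> b' t [tF _]; apply/seteqP; split=> y /diff_universal; apply.
rewrite sO => le.
rewrite (leq_trans (n := 2 ^ r * 2 ^ (dist v x - r)))//.
  by rewrite -expnD leq_exp2l//; lia.
by apply: leq_trans (leq_mul (leqnn _) le) _; rewrite (mulnC (size L)) !mulnA.
Qed.

(** * Comparing two translations *)

Section Translations.
Variables (U V : set G) (cU : COS U) (cV : COS V) (g h : G).
Variables (r r' : nat -> T) (l l' : nat).
Hypotheses (rr : ray r) (rr' : ray r') (l0 : 0 < l) (l'0 : 0 < l').
Hypotheses (gr : forall i, g (r i) = r (i + l)).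
Hypotheses (hr' : forall i, h (r' i) = r' (i + l')).
Variables (n0 : nat) (k : nat -> nat).
Hypothesis small : forall n, n0 <= n ->
  cindex U V (g ^+ n)%g (h ^+ (k n))%g ^ 4 < 2 ^ n.

Let v := r 0.

Lemma exp_ray (f : G) (p : nat -> T) m i n : (forall i, f (p i) = p (i + m)) ->
  (f ^+ n)%g (p i) = p (i + n * m).
Proof.
move=> fp; elim: n => [|n IH]; first by rewrite addn0.
by rewrite expgS GFF_valM IH fp mulSnr addnA.
Qed.

Lemma dist_exp (f : G) x n : dist x ((f ^+ n)%g x) <= n * dist x (f x).
Proof.
elim: n => [|n IH]; first by rewrite distxx.
apply: leq_trans (dist_triangle c (f x) _ _) _.
by rewrite expgS GFF_valM dist_aut mulSn leq_add2l.
Qed.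

(** The index is at least 2 to the power of this distance, up to a constant,
    while its fourth power is less than [2 ^ n]. *)
Lemma vertex_close : exists C, forall n, n0 <= n ->
  4 * dist ((g ^+ n)%g v) ((h ^+ k n)%g v) <= n + C.
Proof.
have [C CP] := vertex_bound v cU cV; exists (4 * C) => n /small.
move: (CP (g ^+ n)%g (h ^+ k n)%g); set D := dist _ _; set J := cindex _ _ _ _.
move=> DC J4; rewrite -(@leq_exp2l 2)// mulnC expnM.
have : (2 ^ D) ^ 4 <= (C * J) ^ 4 by rewrite leq_exp2r.
move=> /leq_trans; apply; rewrite expnMn expnD mulnC leq_mul//; first exact: ltnW.
by rewrite mulnC expnM leq_exp2r// ltnW// ltn_expl.
Qed.

Lemma dist_gn n x : n <= dist ((g ^+ n)%g v) x + dist v x.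
Proof.
have := dist_triangle c x v ((g ^+ n)%g v).
rewrite (exp_ray 0 n gr) ray_dist// (dist_sym c x).
have : n <= n * l by rewrite leq_pmulr.
lia.
Qed.

(** The element [h] is a translation, and [(h ^+ k n) v] is close to
    [(g ^+ n) v], whose distance to [v] is linear in [n]. *)
Lemma k_linear : exists C, forall n, n0 <= n -> k n <= C * n.+1.
Proof.
have [C CP] := vertex_close; set e := dist v (r' 0).
exists (C + 2 * e + l + 1) => n /CP nC.
have kl : k n <= dist (r' 0) ((h ^+ k n)%g (r' 0)).
  by rewrite (exp_ray 0 _ hr') ray_dist// leq_pmulr.
have t1 := dist_triangle c v (r' 0) ((h ^+ k n)%g (r' 0)).
have t2 := dist_triangle c ((h ^+ k n)%g v) v ((h ^+ k n)%g (r' 0)).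
have t3 := dist_triangle c ((g ^+ n)%g v) v ((h ^+ k n)%g v).
rewrite (exp_ray 0 _ gr) ray_dist// in t3.
rewrite -(exp_ray 0 _ gr) -/v in t3.
rewrite dist_aut -/e in t2; rewrite (dist_sym c _ v) -/e in t1.
have tn : k n <= n * l + n + C + 2 * e by lia.
apply: leq_trans tn _; rewrite mulnS !mulnDl mul1n (mulnC n l).
by move: (C * n) (2 * e * n) => ? ?; lia.
Qed.

Lemma k_unbounded K : exists N, forall n, N <= n -> K <= k n.
Proof.
have [C CP] := vertex_close; set e := dist v (h v).
exists (n0 + C + 4 * (K * e) + 1) => n nN; rewrite leqNgt; apply/negP => kK.
have nC := CP n (ltac:(lia)).
have := dist_gn n ((h ^+ k n)%g v); have := dist_exp h v (k n); rewrite -/e.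
have : k n * e <= K * e by rewrite leq_mul2r ltnW// orbT.
lia.
Qed.

Lemma linear_lt_exp C : exists N, forall n, N <= n ->
  2 ^ n * (C * n.+1) ^ 4 * 2 ^ C < 2 ^ (4 * n).
Proof.
exists (10 * C + 100) => n nN.
(* From m < 2 ^ m for m = n %/ 8 one has n.+1 <= 2 ^ (n %/ 8 + 3). *)
have Cn : C * n.+1 <= 2 ^ (C + (n %/ 8 + 3)).
  rewrite expnD leq_mul// ?(ltnW (ltn_expl _ _))// expnD.
  have : n %/ 8 < 2 ^ (n %/ 8) by rewrite ltn_expl.
  have := divn_eq n 8; have := ltn_pmod n (isT : 0 < 8); lia.
have : (C * n.+1) ^ 4 <= 2 ^ (4 * (C + (n %/ 8 + 3))).
  by rewrite (mulnC 4) expnM leq_exp2r.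
move=> /(leq_mul (leqnn (2 ^ n))) /leq_mul/(_ (leqnn (2 ^ C))) /leq_ltn_trans; apply.
by rewrite -!expnD ltn_exp2l//; lia.
Qed.

Lemma diff_exp_seq (f : G) A m z : (forall z, diff 1%g f z -> z \in A) ->
  diff 1%g (f ^+ m)%g z -> z \in [seq (f ^+ t)%g y | t <- iota 0 m, y <- A].
Proof.
move=> fA; rewrite valX => /(@diff_exp _ _ c F f 0 m)[t tm /fA tA].
apply/allpairsP; exists (t, ((f ^+ t)^-1)%g z); split; rewrite ?mem_iota//=.
  by move: tA; rewrite -valX.
by rewrite GFF_mulKV.
Qed.

(** Otherwise the index is at least [2 ^ n], up to a factor that is linear in
    [n], since [z] is at distance about [n] or more from [(g ^+ n) v]. *)
Lemma diff_eventually_empty z : exists N, forall n, N <= n ->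
  ~ diff (g ^+ n)%g (h ^+ k n)%g z.
Proof.
have [C CP] := diff_bound v cU cV; have [Ck CkP] := k_linear.
have [A AP] := diff_finite g; have [B BP] := diff_finite h.
pose e := dist v z; pose C' := C * (size A + Ck * size B).
have [N NP] := linear_lt_exp (C' + 4 * e).
exists (N + n0) => n nN dz.
have nn0 : n0 <= n by lia.
pose D := [seq (g ^+ t)%g y | t <- iota 0 n, y <- A] ++
          [seq (h ^+ t)%g y | t <- iota 0 (k n), y <- B].
have DP y : diff (g ^+ n)%g (h ^+ k n)%g y -> y \in D.
  rewrite mem_cat => /(diff_triangle 1%g)[/diff_sym|] /diff_exp_seq.
    by move=> /(_ _ AP) ->.
  by move=> /(_ _ BP) ->; rewrite orbT.
have sD : size D <= (size A + Ck * size B) * n.+1.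
  rewrite size_cat !size_allpairs !size_iota mulnDl.
  have := CkP _ nn0; move: (k n) => kn /(leq_mul (leqnn (size B))).
  by rewrite (mulnC _ kn) mulnCA -mulnA; lia.
have := CP _ _ _ DP _ dz; set J := cindex _ _ _ _; set di := dist _ _ => le.
have J4 : J ^ 4 < 2 ^ n := small nn0.
have nd : n <= di + e := dist_gn n z.
have : 2 ^ (4 * n) <= 2 ^ n * (C' * n.+1) ^ 4 * 2 ^ (4 * e).
  rewrite (leq_trans (n := (2 ^ di) ^ 4 * 2 ^ (4 * e)))//.
    by rewrite -expnM -expnD leq_exp2l//; lia.
  rewrite leq_mul2r; apply/orP; right.
  have : (2 ^ di) ^ 4 <= (C * J * size D) ^ 4 by rewrite leq_exp2r.
  move=> /leq_trans; apply.
  rewrite /C' -mulnA (mulnC J) mulnA [leqLHS]expnMn mulnC leq_mul// ?(ltnW J4)//.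
  by rewrite leq_exp2r// -!mulnA leq_mul2l sD orbT.
apply/negP; rewrite -ltnNge; apply: leq_ltn_trans (NP n _); last lia.
apply: leq_mul; last by rewrite leq_exp2l// leq_addl.
by rewrite leq_mul2l leq_exp2r// leq_mul2r leq_addr !orbT.
Qed.

Lemma same_end : exists p q, forall i, r (i + p) = r' (i + q).
Proof.
have [r'' [rr'' r''0 [p [q r''E]]]] := ray_from c v rr'.
suff E : r =1 r'' by exists p, q => i; rewrite E r''E.
have [C CP] := vertex_close; set e := dist v (r' q).
apply: (ray_eq (c := c) rr rr'') => [|m]; first by rewrite r''0.
pose n := n0 + C + 4 * (m + e) + 1.
have nn0 : n0 <= n by rewrite /n; lia.
exists (n * l), (k n * l' + p); rewrite r''E (addnC _ q).
have t := dist_triangle c ((h ^+ k n)%g v) ((g ^+ n)%g v) ((h ^+ k n)%g (r' q)).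
rewrite dist_aut -/e (exp_ray 0 n gr) (exp_ray q (k n) hr') add0n in t.
have := CP _ nn0; rewrite (exp_ray 0 n gr) add0n => nC.
have : n <= n * l by rewrite leq_pmulr.
rewrite /n in t nC *; lia.
Qed.

(** Since the rays agree, it suffices to locate where the powers differ. In the
    limit they differ nowhere, so that a difference comes from a later power;
    it also comes from an earlier power, hence lies near the current one. *)
Lemma powers_stay_close : exists w C, forall n,
  (g ^+ (l' * n))%g w = (h ^+ (l * n))%g w /\
  forall z, diff (g ^+ (l' * n))%g (h ^+ (l * n))%g z ->
    dist ((g ^+ (l' * n))%g w) z <= C.
Proof.
have [p [q pq]] := same_end; pose w := r p.
have gw t : (g ^+ t)%g w = r (p + t * l) by exact: exp_ray gr.
have hw t : (h ^+ t)%g w = r (p + t * l').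
  by rewrite /w -[p]add0n pq (exp_ray _ _ hr') add0n addnC -pq addnC.
have [A AP] := diff_finite g; have [B BP] := diff_finite h.
pose C := \max_(y <- A ++ B) dist w y.
have near (f : G) m t z : (forall y, diff 1%g f y -> y \in A ++ B) ->
    (f ^+ t)%g w = r (p + m) -> diff 1%g f (((val f) ^+ t)^-1%g z) ->
    dist (r (p + m)) z <= C.
  move=> fAB fw /fAB; rewrite -valX => yAB.
  rewrite -fw -(GFF_mulKV (f ^+ t)%g z) dist_aut.
  exact: (leq_bigmax_seq (F := dist w)).
have AP' y : diff 1%g g y -> y \in A ++ B by move=> /AP; rewrite mem_cat => ->.
have BP' y : diff 1%g h y -> y \in A ++ B.
  by move=> /BP; rewrite mem_cat orbC => ->.
exists w, (3 * C) => n; split; first by rewrite gw hw; congr (r (p + _)); lia.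
move=> z; rewrite gw => dz; pose m := l' * n * l; have mE : m = l * n * l' by rewrite /m; lia.
have [i im iz] : exists2 i, m <= i & dist (r (p + i)) z <= C.
  have [N NP] := diff_eventually_empty z.
  have [N' N'P] := k_unbounded (l * n).
  pose M := N + N' + l' * n.
  have [Mg Mh] : l' * n <= M /\ l * n <= k M by split; [rewrite /M; lia | apply: N'P; rewrite /M; lia].
  case: (diff_triangle (g ^+ M)%g dz) => [|/(diff_triangle (h ^+ k M)%g)[|]].
  - rewrite !valX -(subnKC Mg) => /diff_exp[t /andP[nt _]] /(near g (t * l) _ _ AP' (gw t)).
    by exists (t * l) => //; rewrite /m leq_mul2r nt orbT.
  - by move=> /(NP M); case; rewrite /M; lia.
  - move=> /diff_sym; rewrite !valX -(subnKC Mh) => /diff_exp[t /andP[nt _]].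
    move=> /(near h (t * l') _ _ BP' (hw t)).
    by exists (t * l') => //; rewrite mE leq_mul2r nt orbT.
have [j jm jz] : exists2 j, j <= m & dist (r (p + j)) z <= C.
  case: (diff_triangle 1%g dz) => [/diff_sym|]; rewrite valX.
    move=> /(@diff_exp _ _ c F g 0)[t /andP[_ nt]] /(near g (t * l) _ _ AP' (gw t)).
    by exists (t * l) => //; rewrite /m leq_mul2r ltnW// orbT.
  move=> /(@diff_exp _ _ c F h 0)[t /andP[_ nt]] /(near h (t * l') _ _ BP' (hw t)).
  by exists (t * l') => //; rewrite mE leq_mul2r ltnW ?orbT.
have ji : i <= j + 2 * C.
  have := dist_triangle c z (r (p + j)) (r (p + i)).
  have : j <= i by lia.
  move=> ji; rewrite (_ : p + i = p + j + (i - j)) in iz *; last by lia.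
  by rewrite ray_dist// (dist_sym c z); lia.
have := dist_triangle c (r (p + j)) (r (p + m)) z.
rewrite (dist_sym c (r (p + m)) (r (p + j))).
have := ray_dist c (p + j) (m - j) rr.
rewrite (_ : p + j + (m - j) = p + m); last by lia.
rewrite -/m; lia.
Qed.

End Translations.
End Counting.

(** * The asymptotic relation and the pseudometric *)

Section Asymptotic.
Variables (R : realType) (G : topologicalGroupType).
Implicit Types (U V W : set G) (g h f : G).

Lemma ler_ln_nat (m n : nat) : 0 < m -> m <= n ->
  (ln (m%:R : R) <= ln (n%:R : R))%R.
Proof.
by move=> m0 mn; rewrite ler_ln ?posrE ?ltr0n ?ler_nat ?(leq_trans m0).
Qed.

Definition index_prod U V := coset_index U (U `&` V) * coset_index V (U `&` V).

Lemma cos_distE U V : cos_dist R U V = ln ((index_prod U V)%:R : R).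
Proof. by []. Qed.

Lemma index_prod_gt0 U V : COS U -> COS V -> 0 < index_prod U V.
Proof.
move=> cU cV; rewrite muln_gt0 coset_index_gt0//= (setIC U).
exact: coset_index_gt0.
Qed.

Lemma cos_dist_sym U V : cos_dist R U V = cos_dist R V U.
Proof. by rewrite /cos_dist setIC mulnC. Qed.

Lemma cos_dist_conj g U V : COS U -> COS V ->
  (cos_dist R (conjset g U) (conjset g V) <= cos_dist R U V)%R.
Proof.
move=> cU cV; rewrite !cos_distE; apply: ler_ln_nat.
  by apply: index_prod_gt0; exact: COS_conj.
apply: leq_mul; first exact: coset_index_conj.
by rewrite (setIC U) (setIC (conjset g U)); exact: coset_index_conj.
Qed.

Lemma cos_dist_triangle V U W : COS U -> COS V -> COS W ->
  (cos_dist R U W <= cos_dist R U V + cos_dist R V W)%R.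
Proof.
move=> cU cV cW; rewrite !cos_distE -lnM ?posrE ?ltr0n ?index_prod_gt0//.
rewrite -natrM; apply: ler_ln_nat; first exact: index_prod_gt0.
rewrite /index_prod mulnACA leq_mul//; first exact: coset_index_trans.
rewrite (setIC U W) (setIC U V) (setIC V W) mulnC; exact: coset_index_trans.
Qed.

Lemma asymptotic_sym g h : asymptotic R g h -> asymptotic R h g.
Proof.
move=> [k [l [U [V [k0 l0 cU cV [M MP]]]]]]; exists l, k, V, U; split=> //.
by exists M => n; rewrite cos_dist_sym.
Qed.

Lemma asymptotic_trans g h f :
  asymptotic R g h -> asymptotic R h f -> asymptotic R g f.
Proof.
move=> [k [l [U [V [k0 l0 cU cV [M MP]]]]]].
move=> [k' [l' [U' [V' [k'0 l'0 cU' cV' [M' MP']]]]]].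
exists (k * k'), (l' * l), U, V'; split=> //; rewrite ?muln_gt0 ?k0 ?l'0//.
exists (M + cos_dist R V U' + M')%R => n.
have := MP (k' * n); have := MP' (l * n); rewrite !mulnA (mulnC k' l) => h1 h2.
set A := conjset (g ^+ (k * k' * n))%g U in h2 *.
set D := conjset (f ^+ (l' * l * n))%g V' in h1 *.
set B := conjset _ V in h2; set E := conjset _ U' in h1.
have cA : COS A by exact: COS_conj.
have cB : COS B by exact: COS_conj.
have cD : COS D by exact: COS_conj.
have cE : COS E by exact: COS_conj.
apply: le_trans (cos_dist_triangle cA cE cD) _; apply: lerD => //.
apply: le_trans (cos_dist_triangle cA cB cE) _; apply: lerD => //.
exact: cos_dist_conj.
Qed.

Lemma asymptotic_class_eq g h : asymptotic R g h ->
  asymptotic_class R g = asymptotic_class R h.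
Proof.
move=> gh; apply/seteqP; split=> f /=; apply: asymptotic_trans => //.
exact: asymptotic_sym.
Qed.

(** Up to conjugation, the conjugate of U by the power of [h] is one of finitely
    many conjugates of U. *)
Lemma asymptotic_finite_cosets U g h k l (L : seq G) : COS U ->
  0 < k -> 0 < l ->
  (forall n, exists2 m, m \in L & U (m^-1 * ((g ^+ (k * n))^-1 * h ^+ (l * n)))%g) ->
  asymptotic R g h.
Proof.
move=> cU k0 l0 LP; exists k, l, U, U; split=> //.
exists (ln ((\max_(m <- L) index_prod U (conjset m U))%:R : R)) => n.
have [m mL Um] := LP n; have [sU _ _] := cU.
have -> : conjset (h ^+ (l * n))%g U = conjset (g ^+ (k * n))%g (conjset m U).
  rewrite -conjsetM -[in RHS](conjset_id sU Um) -conjsetM; congr (conjset _ U).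
  by rewrite !mulgA mulgK mulgV mul1g.
apply: le_trans (cos_dist_conj _ cU (COS_conj m cU)) _.
rewrite cos_distE; apply: ler_ln_nat; first exact/index_prod_gt0/COS_conj.
exact: (leq_bigmax_seq (F := fun m => index_prod U (conjset m U))).
Qed.

Section Delta.
Variables (U V : set G) (cU : COS U) (cV : COS V).

(** The minimum is attained: the exponent 0 is always admissible, and the values
    are an increasing function of a natural number. *)
Lemma delta_nP g h n : exists k, delta_n R U V g h n =
  (ln ((coset_index (conjset (g ^+ n)%g U)
          (conjset (g ^+ n)%g U `&` conjset (h ^+ k)%g V))%:R)
     / (n%:R * ln (scale g)%:R))%R.
Proof.
pose J k := coset_index (conjset (g ^+ n)%g U)
          (conjset (g ^+ n)%g U `&` conjset (h ^+ k)%g V).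
pose S := [set k : nat | scale (h ^+ k)%g <= scale (g ^+ n)%g].
have S0 : S 0.
  rewrite /S /= expg0 (leq_trans _ (scale_gt0 _ cU))// leqNgt.
  by apply/negP; exact: (normalized_not_towards cU (conjset1 U)).
have ex : exists m, `[< exists2 k, S k & J k = m >].
  by exists (J 0); apply/asboolP; exists 0.
have [m /asboolP[k Sk Jk] min] := ex_minnP ex.
have sg0 : (0 <= ln (scale g)%:R :> R)%R by rewrite ln_ge0// ler1n (scale_gt0 g cU).
pose A := [set (ln ((J k)%:R) / (n%:R * ln (scale g)%:R))%R | k in S] : set R.
have [] : [set m | A m /\ lbound A m] (least 0%R A).
  apply: (@xgetPex _ 0%R [set m | A m /\ lbound A m]).
  exists (ln ((J k)%:R) / (n%:R * ln (scale g)%:R))%R; split; first by exists k.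
  move=> _ [k' Sk' <-]; rewrite ler_wpM2r ?invr_ge0 ?mulr_ge0//.
  apply: ler_ln_nat; first by apply: coset_index_gt0; exact: COS_conj.
  by rewrite Jk; apply: min; apply/asboolP; exists k'.
by move=> [k' Sk' E] _; exists k'; rewrite E.
Qed.

Lemma delta_n_ge0 g h n : (0 <= delta_n R U V g h n)%R.
Proof.
have [k ->] := delta_nP g h n; rewrite divr_ge0 ?mulr_ge0//; apply: ln_ge0.
  by rewrite ler1n; apply: coset_index_gt0; exact: COS_conj.
by rewrite ler1n (scale_gt0 g cU).
Qed.

Lemma delta_plus_ge0 g h : (0 <= delta_plus R U V g h)%E.
Proof.
apply: limf_esup_ge0 => [|n]; last by rewrite lee_fin delta_n_ge0.
exact: filter_not_empty.
Qed.

Lemma delta_plus_lt g h (e : R) : (delta_plus R U V g h < e%:E)%E ->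
  exists n0, forall n, n0 <= n -> (delta_n R U V g h n < e)%R.
Proof.
move=> /ereal_inf_lt[_ [A [n0 _ nA] <-] Ae]; exists n0 => n nn0.
rewrite -lte_fin; apply: le_lt_trans Ae; apply: ereal_sup_ubound.
by exists n => //; exact: nA.
Qed.

(** The bound on [delta_plus] is chosen such that [n * ln (scale g)] cancels and
    the logarithm of the index is compared with [n * ln 2 / 4]. *)
Lemma delta_plus_small_index g h : towards_infinity g ->
  (delta_plus R U V g h < (ln 2 / (4 * ln (scale g)%:R))%:E)%E ->
  exists n0, forall n, n0 <= n -> exists k,
    coset_index (conjset (g ^+ n)%g U)
      (conjset (g ^+ n)%g U `&` conjset (h ^+ k)%g V) ^ 4 < 2 ^ n.
Proof.
move=> tg /delta_plus_lt[n0 n0P]; exists n0.+1 => n nn0.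
have := n0P n (ltnW nn0); have [k ->] := delta_nP g h n.
set J := coset_index _ _ => Jlt; exists k.
have J0 : 0 < J by apply: coset_index_gt0; exact: COS_conj.
have s0 : (0 < ln (scale g)%:R :> R)%R by rewrite ln_gt0// ltr1n.
have n0' : (0 < n%:R :> R)%R by rewrite ltr0n (leq_trans _ nn0).
rewrite -(ltr_nat R) !natrX -ltr_ln ?posrE ?exprn_gt0 ?ltr0n// !lnXn ?ltr0n//.
move: Jlt; rewrite ltr_pdivrMr ?mulr_gt0// => Jlt.
rewrite -[ltLHS]mulr_natl -[ltRHS]mulr_natl.
have -> : (n%:R * ln 2 = 4 * (ln 2 / (4 * ln (scale g)%:R) * (n%:R * ln (scale g)%:R)) :> R)%R.
  by field; rewrite gt_eqF.
by rewrite ltr_pM2l.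
Qed.

End Delta.

Lemma boundary_reprP (x : @boundary R G) :
  towards_infinity (boundary_repr x) /\
  asymptotic_class R (boundary_repr x) = val x.
Proof.
apply: (@xgetPex _ 1%g [set g | towards_infinity g /\ asymptotic_class R g = val x]).
by have [g tg gx] := set_valP x; exists g.
Qed.

End Asymptotic.

Section Main.
Variables (R : realType) (d : nat) (T : regular_tree d) (c : legal_colouring T).
Variables (F F' : {group 'S_d}) (sFF' : F \subset F').
Variable F2 : two_transitive F.
Local Notation G := (GFF c sFF').

(** The powers with exponents [l' * n] and [l * n] translate by the same length
    along the common ray of [g] and [h]. *)
Lemma small_index_asymptotic (U V : set G) (g h : G) n0 :
  COS U -> COS V -> towards_infinity g -> towards_infinity h ->
  (forall n, n0 <= n -> exists k, cindex U V (g ^+ n)%g (h ^+ k)%g ^ 4 < 2 ^ n) ->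
  asymptotic R g h.
Proof.
move=> cU cV tg th.
have d3 := towards_infinity_degree cU tg.
have [r [l [rr l0 gr]]] := translation_ray c (towards_infinity_hyperbolic cU tg).
have [r' [l' [rr' l'0 hr']]] := translation_ray c (towards_infinity_hyperbolic cU th).
move=> small.
have /choice[k kP] : forall n, exists k, n0 <= n ->
    cindex U V (g ^+ n)%g (h ^+ k)%g ^ 4 < 2 ^ n.
  move=> n; have [/small[k kn]|] := leqP n0 n; first by exists k.
  by exists 0.
have [w [C wC]] := powers_stay_close F2 d3 cU cV rr rr' l0 l'0 gr hr' kP.
have [s sU] := COS_stab cU.
have [L LP] := finitely_many_cosets c sFF' w s C.
have := @asymptotic_finite_cosets R _ U g h l' l L cU l'0 l0; apply=> n.
have [wn dn] := wC n; set m := (_ * _)%g.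
have [||y yL ys] := LP m; last by exists y => //; exact: sU.
  by rewrite /m GFF_valM -wn GFF_mulVK distxx.
move=> z dz; rewrite -(dist_aut c (g ^+ (l' * n))%g); apply: dn.
rewrite -[val _](mulg1 _) (_ : val (h ^+ _)%g = (val (g ^+ (l' * n)) * val m)%g).
  by apply/diff_mul; move: dz; rewrite -{1}(GFF_mulVK (g ^+ (l' * n))%g z).
rewrite -[RHS]/(val (g ^+ (l' * n) * m)%g) /m mulgA mulgV mul1g.
by [].
Qed.

End Main.

Theorem theorem4p15 (R : realType) (d : nat) (T : regular_tree d)
    (c : legal_colouring T) (F F' : {group 'S_d}) (sFF' : F \subset F')
    (F2 : two_transitive F)
    (U V : set (GFF c sFF')) (cosU : COS U) (cosV : COS V) :
  induces_discrete_topology (@delta R (GFF c sFF') U V).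
Proof.
move=> O x Ox; have [tx cx] := boundary_reprP x.
set g := boundary_repr x in tx cx.
have s0 : (0 < ln (scale g)%:R :> R)%R by rewrite ln_gt0// ltr1n.
exists (ln 2 / (4 * ln (scale g)%:R))%R.
  by rewrite divr_gt0 ?mulr_gt0// ln_gt0// ltr1n.
move=> y /= dxy; have [ty cy] := boundary_reprP y.
suff -> : y = x by [].
apply: val_inj; rewrite -cx -cy; apply/esym/asymptotic_class_eq.
have : (delta_plus R U V g (boundary_repr y) < (ln 2 / (4 * ln (scale g)%:R))%:E)%E.
  by apply: le_lt_trans dxy; rewrite leeDl// delta_plus_ge0.
move=> /(delta_plus_small_index cosU cosV tx)[n0 small].
exact (@small_index_asymptotic R _ _ _ _ _ _ F2 _ _ _ _ _ cosU cosV tx ty small).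
Qed.
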